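(* Let $0<p<q\le 1$, $\tau\ge 0$, $0\le\eta<1$, $\kappa,\xi\in\mathbb{N}_0$, $0\le\rho<1$, and let $\varphi\in\mathcal{P}_{p,q}^{\xi,\kappa}(\tau,\eta)$, $\varphi(z)=z-\sum_{\nu=2}^{\infty}c_\nu z^\nu$ with $c_\nu\ge0$. Then $\varphi$ is convex of order $\rho$ in $|z|<r_3$, where $$r_3:=\inf_{\nu\ge2}\left(\frac{(1-\rho)\nu^{-1}[\nu]_{p,q}^{\kappa}(\nu-\eta)\big\{1+([\nu]_{p,q}-1)\tau\big\}[1+(\nu-1)\tau]^{\xi}}{(\nu-\rho)(1-\eta)}\right)^{1/(\nu-1)} .$$ The result is sharp, with extremal function $$\varphi(z)=z-\frac{1-\eta}{[\nu]_{p,q}^{\kappa}(\nu-\eta)\big\{1+([\nu]_{p,q}-1)\tau\big\}[1+(\nu-1)\tau]^{\xi}}\,z^{\nu}\qquad(\nu\ge2).$$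
   Context: $\Omega=\{z\in\mathbb{C}:|z|<1\}$; $\mathbb{N}_0=\mathbb{N}\cup\{0\}$. $\mathcal{A}$ is the class of analytic functions $\varphi$ on $\Omega$ with $\varphi(0)=0$, $\varphi'(0)=1$, so $\varphi(z)=z+\sum_{\nu\ge2}c_\nu z^\nu$. For $0<p<q\le1$, $[\nu]_{p,q}=\frac{p^\nu-q^\nu}{p-q}=\sum_{j=0}^{\nu-1}p^{\nu-1-j}q^{j}$. For $\varphi\in\mathcal{A}$, $\tau\ge0$, $\kappa,\xi\in\mathbb{N}_0$ define the operator $$\Upsilon_{\tau,p,q}^{\xi,\kappa}\varphi(z)=z+\sum_{\nu=2}^{\infty}[\nu]_{p,q}^{\kappa}[1+(\nu-1)\tau]^{\xi}c_\nu z^\nu .$$ For $0\le\eta<1$, $\tau\ge0$, $\mathcal{Q}_{p,q}^{\xi,\kappa}(\tau,\eta)$ is the class of $\varphi\in\mathcal{A}$ such that for all $z\in\Omega$ $$\operatorname{Re}\left\{\frac{(1-\tau)z\big(\Upsilon_{\tau,p,q}^{\xi,\kappa}\varphi(z)\big)'+\tau z\big(\Upsilon_{\tau,p,q}^{\xi,\kappa+1}\varphi(z)\big)'}{(1-\tau)\Upsilon_{\tau,p,q}^{\xi,\kappa}\varphi(z)+\tau\Upsilon_{\tau,p,q}^{\xi,\kappa+1}\varphi(z)}\right\}>\eta .$$ $\mathcal{T}$ is the subclass of $\mathcal{A}$ of functions of the form $\varphi(z)=z-\sum_{\nu=2}^{\infty}c_\nu z^\nu$ with all $c_\nu\ge0$,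 and $\mathcal{P}_{p,q}^{\xi,\kappa}(\tau,\eta)=\mathcal{Q}_{p,q}^{\xi,\kappa}(\tau,\eta)\cap\mathcal{T}$. Convex of order $\rho$ in $|z|<r$ means $\operatorname{Re}\{1+z\varphi''(z)/\varphi'(z)\}>\rho$ for $|z|<r$. ''Sharp'' means that the radius cannot be replaced by a larger one valid for all functions in the class.
   Formalization: It is additionally assumed that 1+([ν]_{p,q}−1)τ>0 for all ν≥2, i.e. τ≤1 or q=1; if τ>1 and q<1 this quantity is negative for all large ν, so r_3 involves even roots of negative numbers and is undefined. *)

(* Defs.v *)
From Stdlib Require Import Reals Arith.
From Coquelicot Require Import Coquelicot.
Open Scope R_scope.

Definition in_disc (z : C) : Prop := Cmod z < 1.

(** Coquelicot's [C_derive] is total; it is the complex derivative wherever the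
    latter exists ([is_C_derive_unique]). *)
Definition C_derive_n (n : nat) (phi : C -> C) : C -> C :=
  Nat.iter n C_derive phi.

Definition taylor_coef (phi : C -> C) (nu : nat) : C :=
  (C_derive_n nu phi 0 / INR (fact nu))%C.

(** Coquelicot's total operator [Series] is only available on [R], so complex
    series are summed componentwise. *)
Definition CSeries (a : nat -> C) : C :=
  (Series (fun k => Re (a k)), Series (fun k => Im (a k))).

(** Elements of the classes below are total functions [C -> C]; only their
    values on the unit disc matter for membership. *)
Definition class_A (phi : C -> C) : Prop :=
  (forall z : C, in_disc z -> ex_derive phi z) /\
  phi 0 = 0 /\ C_derive phi 0 = 1.

Definition class_T (phi : C -> C) : Prop :=
  class_A phi /\
  exists c : nat -> R,
    (forall nu : nat, (2 <= nu)%nat -> 0 <= c nu) /\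
    forall z : C, in_disc z ->
      is_series (K := C_AbsRing) (V := C_NormedModule)
        (fun k : nat => (c (k + 2)%nat * z ^ (k + 2))%C) (z - phi z)%C.

Definition pq_number (p q : R) (nu : nat) : R := (p ^ nu - q ^ nu) / (p - q).

(** The sum over [nu >= 2] is indexed by [k = nu - 2]. *)
Definition Upsilon (p q tau : R) (xi kappa : nat) (phi : C -> C) (z : C) : C :=
  (z + CSeries (fun k : nat =>
         let nu := (k + 2)%nat in
         (pq_number p q nu ^ kappa * (1 + (INR nu - 1) * tau) ^ xi)%R
           * taylor_coef phi nu * z ^ nu))%C.

Definition class_Q (p q tau eta : R) (xi kappa : nat) (phi : C -> C) : Prop :=
  class_A phi /\
  let U0 := Upsilon p q tau xi kappa phi in
  let U1 := Upsilon p q tau xi (S kappa) phi in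
  (** At [z = 0] the quotient reads [0 / 0]; it has there a removable
      singularity with value [1 > eta], so only [z <> 0] carries a condition.
      Elsewhere the denominator is required not to vanish, since division is
      total. *)
  forall z : C, in_disc z -> z <> 0 ->
    let den := ((1 - tau)%R * U0 z + tau * U1 z)%C in
    den <> 0 /\
    Re (((1 - tau)%R * z * C_derive U0 z + tau * z * C_derive U1 z) / den)%C
      > eta.

Definition class_P (p q tau eta : R) (xi kappa : nat) (phi : C -> C) : Prop :=
  class_Q p q tau eta xi kappa phi /\ class_T phi.

(** [phi' <> 0] is the condition that the quotient makes sense. *)
Definition convex_of_order (rho r : R) (phi : C -> C) : Prop :=
  forall z : C, Cmod z < r ->
    C_derive phi z <> 0 /\
    Re (1 + z * C_derive (C_derive phi) z / C_derive phi z)%C > rho.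

Definition factor (p q tau : R) (nu : nat) : R :=
  1 + (pq_number p q nu - 1) * tau.

Definition radius_term (p q tau eta rho : R) (xi kappa nu : nat) : R :=
  Rpower
    ((1 - rho) * / INR nu * pq_number p q nu ^ kappa * (INR nu - eta)
       * factor p q tau nu * (1 + (INR nu - 1) * tau) ^ xi
     / ((INR nu - rho) * (1 - eta)))
    (1 / (INR nu - 1)).

(** The set of terms is nonempty and bounded below by [0], so [Glb_Rbar] is
    finite. One has [r3 <= 1], so that [|z| < r3] stays inside the disc. *)
Definition r3 (p q tau eta rho : R) (xi kappa : nat) : R :=
  real (Glb_Rbar (fun x : R =>
    exists nu : nat,
      (2 <= nu)%nat /\ x = radius_term p q tau eta rho xi kappa nu)).

Definition extremal (p q tau eta : R) (xi kappa nu : nat) (z : C) : C :=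
  (z - ((1 - eta) / (pq_number p q nu ^ kappa * (INR nu - eta)
          * factor p q tau nu * (1 + (INR nu - 1) * tau) ^ xi))%R * z ^ nu)%C.

(* Main.v *)
Require Import Defs.
From Stdlib Require Import Reals Arith Lra Lia.
From Coquelicot Require Import Coquelicot.
Open Scope R_scope.

(** For g(z) = z - sum_(nu>=2) b_nu z^nu with b_nu >= 0, put t = |z|.  If
    sum (nu - alpha) b_nu t^(nu-1) < 1 - alpha, then
    |z g'/g - 1| <= sum (nu-1) b_nu t^(nu-1) / (1 - sum b_nu t^(nu-1)) < 1 - alpha,
    so Re (z g'/g) > alpha.  Conversely, letting z tend to 1 along the reals,
    Re (z g'/g) > alpha on the disc forces sum (nu - alpha) b_nu <= 1 - alpha.
    The quotient defining the class Q is z g'/g for a g with coefficients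
    b_nu = D_nu c_nu, D_nu > 0, hence membership of phi in P amounts to
    sum (nu - eta) D_nu c_nu <= 1 - eta.  Since 1 + z phi''/phi' = z g'/g for
    g = z phi', convexity of order rho at z follows from
    sum nu (nu - rho) c_nu t^(nu-1) < 1 - rho, and for t < r3 the first
    inequality implies the second one term by term. *)

(** * Complex series *)

(** Membership concerns total functions known only on the disc, and [Upsilon] reads its coefficients
    off iterated derivatives at 0. Termwise differentiation of [CPS] ties both to one real sequence;
    real coefficients suffice because of [class_T]. The invariant is [rad1], which survives every
    multiplier of at most linear growth. Since nothing is known of phi outside the disc, r3 <= 1 has
    to be proved. The number D_nu is [factor] times [weight], and its sign rests on [hpos]: for q <
    1 the numbers [nu] tend to 0, so for tau > 1 [factor] is negative for large nu. The sufficient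
    conditions ask for one bound M < 1 - alpha on all partial sums, because strict bounds on the
    single partial sums would be lost in the limit. *)

Lemma fst_sum_n (u : nat -> C) (n : nat) :
  fst (sum_n (G := C_NormedModule) u n) = sum_n (fun k => Re (u k)) n.
Proof.
  induction n as [|n IH].
  - now rewrite !sum_O.
  - rewrite !sum_Sn. simpl. now rewrite <- IH.
Qed.

Lemma snd_sum_n (u : nat -> C) (n : nat) :
  snd (sum_n (G := C_NormedModule) u n) = sum_n (fun k => Im (u k)) n.
Proof.
  induction n as [|n IH].
  - now rewrite !sum_O.
  - rewrite !sum_Sn. simpl. now rewrite <- IH.
Qed.

Lemma is_series_C_components (u : nat -> C) (l : C) :
  is_series (K := C_AbsRing) (V := C_NormedModule) u l ->
  is_series (fun k => Re (u k)) (Re l) /\ is_series (fun k => Im (u k)) (Im l).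
Proof.
  intros H. split; apply filterlim_locally; intros eps;
    pose proof (proj1 (filterlim_locally _ _) H eps) as H';
    revert H'; apply filter_imp; intros n [H1 H2].
  - now rewrite <- fst_sum_n.
  - now rewrite <- snd_sum_n.
Qed.

Lemma CSeries_unique (u : nat -> C) (l : C) :
  is_series (K := C_AbsRing) (V := C_NormedModule) u l -> CSeries u = l.
Proof.
  intros H. apply is_series_C_components in H. destruct H as [H1 H2].
  unfold CSeries. rewrite (is_series_unique _ _ H1), (is_series_unique _ _ H2).
  now destruct l.
Qed.

Lemma im_le_Cmod (c : C) : Rabs (Im c) <= Cmod c.
Proof. eapply Rle_trans; [apply Rmax_r | apply Rmax_Cmod]. Qed.

(** [CSeries] is total, so additivity and index shifts need convergence of both components; summable
    moduli provide it for the two at once. *)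
Definition abs_summable (u : nat -> C) : Prop := ex_series (fun n => Cmod (u n)).

Lemma abs_summable_re (u : nat -> C) :
  abs_summable u -> ex_series (fun n => Re (u n)).
Proof.
  intros H. refine (ex_series_le (K := R_AbsRing) (V := R_CompleteNormedModule)
    _ _ _ H). intros n. apply re_le_Cmod.
Qed.

Lemma abs_summable_im (u : nat -> C) :
  abs_summable u -> ex_series (fun n => Im (u n)).
Proof.
  intros H. refine (ex_series_le (K := R_AbsRing) (V := R_CompleteNormedModule)
    _ _ _ H). intros n. apply im_le_Cmod.
Qed.

Lemma ex_series_Rle (u v : nat -> R) :
  (forall n, Rabs (u n) <= v n) -> ex_series v -> ex_series u.
Proof.
  exact (@ex_series_le R_AbsRing R_CompleteNormedModule u v).
Qed.

Lemma ex_series_Rext (u v : nat -> R) :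
  (forall n, u n = v n) -> ex_series u -> ex_series v.
Proof. exact (@ex_series_ext R_AbsRing R_NormedModule u v). Qed.

Lemma ex_series_Rscal (c : R) (u : nat -> R) :
  ex_series u -> ex_series (fun n => c * u n).
Proof. exact (@ex_series_scal R_AbsRing R_NormedModule c u). Qed.

Lemma pow_le_1 (x : R) (n : nat) : 0 <= x <= 1 -> x ^ n <= 1.
Proof. intros Hx. rewrite <- (pow1 n). now apply pow_incr. Qed.

Lemma sum_n_Rext (u v : nat -> R) (n : nat) :
  (forall k, u k = v k) -> sum_n u n = sum_n v n.
Proof. exact (sum_n_ext (G := R_AbelianMonoid) u v n). Qed.

Lemma sum_n_Rscal (c : R) (u : nat -> R) (n : nat) :
  sum_n (fun k => c * u k) n = c * sum_n u n.
Proof. exact (sum_n_mult_l (K := R_Ring) c u n). Qed.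

Lemma sum_n_Rle (u v : nat -> R) (n : nat) :
  (forall k, (k <= n)%nat -> u k <= v k) -> sum_n u n <= sum_n v n.
Proof.
  induction n as [|n IH]; intros H.
  - rewrite !sum_O. now apply H.
  - rewrite !sum_Sn. apply Rplus_le_compat; [apply IH; intros k Hk|]; apply H; lia.
Qed.

Lemma abs_summable_le (u : nat -> C) (v : nat -> R) :
  (forall n, Cmod (u n) <= v n) -> ex_series v -> abs_summable u.
Proof.
  intros H. apply ex_series_Rle. intros n.
  rewrite Rabs_pos_eq; [apply H | apply Cmod_ge_0].
Qed.

Lemma CSeries_ext (u v : nat -> C) :
  (forall n, u n = v n) -> CSeries u = CSeries v.
Proof.
  intros H. unfold CSeries. f_equal; apply Series_ext; intros n; now rewrite H.
Qed.

Lemma CSeries_plus (u v : nat -> C) :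
  abs_summable u -> abs_summable v ->
  CSeries (fun n => u n + v n)%C = (CSeries u + CSeries v)%C.
Proof.
  intros Hu Hv. unfold CSeries, Cplus; simpl. f_equal.
  - rewrite <- Series_plus; [reflexivity | now apply abs_summable_re ..].
  - rewrite <- Series_plus; [reflexivity | now apply abs_summable_im ..].
Qed.

Lemma CSeries_scal (c : C) (u : nat -> C) :
  abs_summable u -> CSeries (fun n => c * u n)%C = (c * CSeries u)%C.
Proof.
  intros H. apply abs_summable_re in H as Hr. apply abs_summable_im in H as Hi.
  unfold CSeries, Cmult; simpl. f_equal.
  - rewrite <- !Series_scal_l, <- Series_minus; [reflexivity | now apply ex_series_Rscal ..].
  - rewrite <- !Series_scal_l, <- Series_plus; [reflexivity | now apply ex_series_Rscal ..].
Qed.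

Lemma abs_summable_plus (u v : nat -> C) :
  abs_summable u -> abs_summable v -> abs_summable (fun n => u n + v n)%C.
Proof.
  intros Hu Hv. eapply abs_summable_le.
  - intros n. apply Cmod_triangle.
  - now apply (ex_series_plus (V := R_NormedModule)).
Qed.

Lemma abs_summable_scal (c : C) (u : nat -> C) :
  abs_summable u -> abs_summable (fun n => c * u n)%C.
Proof.
  intros H. eapply abs_summable_le.
  - intros n. rewrite Cmod_mult. apply Rle_refl.
  - now apply ex_series_Rscal.
Qed.

Lemma abs_summable_shift (u : nat -> C) :
  abs_summable u -> abs_summable (fun n => u (S n)).
Proof.
  intros H. now apply (ex_series_incr_1 (V := R_NormedModule) (fun n => Cmod (u n))).
Qed.

Lemma CSeries_shift (u : nat -> C) :
  abs_summable u -> CSeries u = (u 0%nat + CSeries (fun n => u (S n)))%C.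
Proof.
  intros H. unfold CSeries, Cplus; simpl. f_equal.
  - apply Series_incr_1. now apply abs_summable_re.
  - apply Series_incr_1. now apply abs_summable_im.
Qed.

Lemma sum_n_le_Series (u : nat -> R) (n : nat) :
  (forall k, 0 <= u k) -> ex_series u -> sum_n u n <= Series u.
Proof.
  intros H Hu. apply Series_correct in Hu.
  apply (is_lim_seq_incr_compare (sum_n u) (Series u) Hu).
  intros k. rewrite sum_Sn. specialize (H (S k)). unfold plus; simpl. lra.
Qed.

(* |S|^2 = Re (conj S * S) is a real series, to which Cauchy-Schwarz applies
   termwise. *)
Lemma Cmod_CSeries (u : nat -> C) :
  abs_summable u -> Cmod (CSeries u) <= Series (fun n => Cmod (u n)).
Proof.
  intros H. set (S := CSeries u).
  destruct (Req_dec (Cmod S) 0) as [E|E].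
  { rewrite E. eapply Rle_trans; [|apply (sum_n_le_Series _ 0); [|exact H]].
    - rewrite sum_O. apply Cmod_ge_0.
    - intros k. apply Cmod_ge_0. }
  pose proof (Cmod_ge_0 S).
  apply Rmult_le_reg_l with (Cmod S); [lra|].
  rewrite <- Series_scal_l.
  replace (Cmod S * Cmod S) with (Re (Cconj S * S)).
  2:{ transitivity (Cmod S ^ 2); [|ring]. rewrite Cmod2_alt. simpl. unfold Re, Im. ring. }
  unfold S at 2. rewrite <- CSeries_scal by exact H. simpl.
  eapply Rle_trans; [apply Rle_abs|].
  assert (B : forall n, Rabs (Re (Cconj S * u n)) <= Cmod S * Cmod (u n)).
  { intros n. rewrite <- (Cmod_conj S), <- Cmod_mult. apply re_le_Cmod. }
  assert (X : ex_series (fun n => Cmod S * Cmod (u n)))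
    by now apply ex_series_Rscal.
  eapply Rle_trans; [apply Series_Rabs|].
  - apply ex_series_Rle with (2 := X). intros n. rewrite Rabs_Rabsolu. apply B.
  - apply Series_le; [|exact X]. intros n. split; [apply Rabs_pos | apply B].
Qed.

Lemma Series_le_bound (u : nat -> R) (M : R) :
  ex_series u -> (forall n, sum_n u n <= M) -> Series u <= M.
Proof.
  intros Hu H. apply Series_correct in Hu.
  apply (is_lim_seq_le (sum_n u) (fun _ => M) (Series u) M H Hu).
  apply is_lim_seq_const.
Qed.

(** * Power series with real coefficients in the unit disc *)

(* The radius of convergence of a is at least 1. *)
Definition rad1 (a : nat -> R) : Prop :=
  forall r : R, 0 <= r < 1 -> ex_series (fun n => Rabs (a n) * r ^ n).

(** The left side is at most n d r^(n-1), the linear term in the binomial expansion of (r + d)^n. It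
    trades a factor n for a slightly larger radius. *)
Lemma INR_mult_pow_le (r d : R) (n : nat) :
  0 <= r <= 1 -> 0 <= d -> INR n * d * r ^ n <= (r + d) ^ n.
Proof.
  intros Hr Hd. induction n as [|n IH].
  - simpl. lra.
  - rewrite S_INR. simpl.
    assert (r ^ n <= (r + d) ^ n) by (apply pow_incr; lra).
    assert (0 <= r ^ n) by (apply pow_le; lra).
    assert (r * (INR n * d * r ^ n) <= r * (r + d) ^ n) by (apply Rmult_le_compat_l; lra).
    assert (d * (r * r ^ n) <= d * (r + d) ^ n) by (apply Rmult_le_compat_l; nra).
    lra.
Qed.

(** With d = (1 - r)/2 the radius r + d stays below 1, and n r^n <= (r + d)^n / d absorbs the linear
    growth of w. *)
Lemma rad1_mult (w a : nat -> R) (M : R) :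
  (forall n, Rabs (w n) <= M * (INR n + 1)) -> rad1 a ->
  rad1 (fun n => w n * a n).
Proof.
  intros Hw Ha r Hr. set (d := (1 - r) / 2).
  assert (Hd : 0 < d) by (unfold d; lra).
  apply ex_series_Rle with (v := fun n => M * (/ d + 1) * (Rabs (a n) * (r + d) ^ n)).
  - intros n. rewrite Rabs_pos_eq.
    2:{ apply Rmult_le_pos; [apply Rabs_pos | apply pow_le; lra]. }
    rewrite Rabs_mult.
    pose proof (INR_mult_pow_le r d n ltac:(lra) ltac:(lra)) as H.
    assert (H1 : r ^ n <= (r + d) ^ n) by (apply pow_incr; lra).
    assert (H2 : INR n * r ^ n <= / d * (r + d) ^ n).
    { apply Rmult_le_reg_l with d; [lra|]. field_simplify; [|lra]. lra. }
    assert (H3 : (INR n + 1) * r ^ n <= (/ d + 1) * (r + d) ^ n) by lra.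
    assert (0 <= r ^ n) by (apply pow_le; lra).
    assert (0 <= M).
    { specialize (Hw 0%nat). simpl in Hw. pose proof (Rabs_pos (w 0%nat)). lra. }
    specialize (Hw n). pose proof (Rabs_pos (a n)).
    apply Rle_trans with (M * (INR n + 1) * Rabs (a n) * r ^ n).
    + apply Rmult_le_compat_r; [easy|]. now apply Rmult_le_compat_r.
    + replace (M * (INR n + 1) * Rabs (a n) * r ^ n)
        with (M * Rabs (a n) * ((INR n + 1) * r ^ n)) by ring.
      replace (M * (/ d + 1) * (Rabs (a n) * (r + d) ^ n))
        with (M * Rabs (a n) * ((/ d + 1) * (r + d) ^ n)) by ring.
      apply Rmult_le_compat_l; [nra | easy].
  - apply ex_series_Rscal. apply Ha. unfold d. lra.
Qed.

Lemma rad1_ext (a b : nat -> R) : (forall n, a n = b n) -> rad1 a -> rad1 b.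
Proof.
  intros H Ha r Hr. apply (ex_series_Rext (fun n => Rabs (a n) * r ^ n)); [|now apply Ha].
  intros n. now rewrite H.
Qed.

Lemma rad1_mult_INR (a : nat -> R) : rad1 a -> rad1 (fun n => INR n * a n).
Proof.
  apply rad1_mult with 1. intros n. rewrite Rabs_pos_eq; [lra | apply pos_INR].
Qed.

(** Radius 0 follows by comparison with a positive radius. This spares the index shift below, which
    divides by r, a separate case. *)
Lemma rad1_pos (a : nat -> R) :
  (forall r, 0 < r < 1 -> ex_series (fun n => Rabs (a n) * r ^ n)) -> rad1 a.
Proof.
  intros Ha r Hr. set (s := (1 + r) / 2).
  assert (Hs : r <= s /\ 0 < s < 1) by (unfold s; lra).
  apply ex_series_Rle with (v := fun n => Rabs (a n) * s ^ n); [|now apply Ha].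
  intros n. rewrite Rabs_mult, Rabs_Rabsolu.
  apply Rmult_le_compat_l; [apply Rabs_pos|].
  rewrite Rabs_pos_eq by (apply pow_le; lra). apply pow_incr. lra.
Qed.

Lemma rad1_shift (a : nat -> R) : rad1 a -> rad1 (fun n => a (S n)).
Proof.
  intros Ha. apply rad1_pos. intros r Hr.
  generalize (Ha r ltac:(lra)). intros H.
  apply (ex_series_incr_1 (V := R_NormedModule)) in H.
  apply ex_series_Rscal with (c := / r) in H. revert H. apply ex_series_Rext.
  intros n. rewrite <- tech_pow_Rmult. field. lra.
Qed.

Lemma rad1_derive (a : nat -> R) : rad1 a -> rad1 (PS_derive a).
Proof. intros Ha. exact (rad1_shift _ (rad1_mult_INR _ Ha)). Qed.

Lemma rad1_one : rad1 (fun _ => 1).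
Proof.
  intros r Hr. apply (ex_series_Rext (fun n => r ^ n)).
  - intros n. rewrite Rabs_R1. ring.
  - apply ex_series_geom. rewrite Rabs_pos_eq; lra.
Qed.

Lemma rad1_terms (a : nat -> R) (z : C) :
  rad1 a -> Cmod z < 1 -> abs_summable (fun n => a n * z ^ n)%C.
Proof.
  intros Ha Hz. apply abs_summable_le with (v := fun n => Rabs (a n) * Cmod z ^ n).
  - intros n. rewrite Cmod_mult, Cmod_R, Cmod_pow. apply Rle_refl.
  - apply Ha. split; [apply Cmod_ge_0 | exact Hz].
Qed.

(** * Complex power series and their termwise derivatives *)

Definition CPS (a : nat -> R) (z : C) : C := CSeries (fun n => a n * z ^ n)%C.

Lemma CPS_ext (a b : nat -> R) (z : C) :
  (forall n, a n = b n) -> CPS a z = CPS b z.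
Proof. intros H. apply CSeries_ext. intros n. now rewrite H. Qed.

Lemma mult_CPS_derive (a : nat -> R) (z : C) :
  rad1 a -> Cmod z < 1 ->
  (z * CPS (PS_derive a) z)%C = CPS (fun n => INR n * a n) z.
Proof.
  intros Ha Hz. unfold CPS.
  rewrite (CSeries_shift (fun n => (INR n * a n)%R * z ^ n)%C).
  2:{ apply rad1_terms; [now apply rad1_mult_INR | easy]. }
  rewrite <- CSeries_scal.
  2:{ apply rad1_terms; [now apply rad1_derive | easy]. }
  simpl (INR 0). rewrite Rmult_0_l, Cmult_0_l, Cplus_0_l.
  apply CSeries_ext. intros n. unfold PS_derive. rewrite Cpow_S. ring.
Qed.

(* The remainder of order 2 in the expansion of (z + h)^n. *)
Definition taylor2 (n : nat) (z h : C) : C :=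
  ((z + h) ^ n - z ^ n - INR n * h * z ^ pred n)%C.

(** Induction on T_(n+1) = (z + h) T_n + n h^2 z^(n-1), closed by n^2 + n <= (n + 1)^2. The factor
    M^2 on the left avoids the exponent n - 2. *)
Lemma Cmod_taylor2 (n : nat) (z h : C) (M : R) :
  0 < M -> Cmod z <= M -> Cmod (z + h)%C <= M ->
  M ^ 2 * Cmod (taylor2 n z h) <= Cmod h ^ 2 * INR n ^ 2 * M ^ n.
Proof.
  intros HM Hz Hzh. pose proof (Cmod_ge_0 h) as Hh.
  induction n as [|n IH].
  - unfold taylor2. simpl (INR 0). replace (_ - _ - _)%C with (RtoC 0).
    + rewrite Cmod_0. simpl. lra.
    + simpl. ring.
  - assert (E : taylor2 (S n) z h = ((z + h) * taylor2 n z h + INR n * (h * h) * z ^ pred n)%C).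
    { unfold taylor2. rewrite S_INR, RtoC_plus. destruct n as [|n]; simpl pred.
      - simpl. ring.
      - rewrite !Cpow_S. ring. }
    assert (B : M ^ 2 * Cmod (INR n * (h * h) * z ^ pred n)%C
                <= Cmod h ^ 2 * INR n * M ^ S n).
    { rewrite !Cmod_mult, Cmod_R, Cmod_pow, Rabs_pos_eq by apply pos_INR.
      destruct n as [|n]; [simpl; lra|]. simpl pred.
      assert (Cmod z ^ n <= M ^ n) by (apply pow_incr; split; [apply Cmod_ge_0 | easy]).
      replace (M ^ 2 * (INR (S n) * (Cmod h * Cmod h) * Cmod z ^ n))
        with ((Cmod h ^ 2 * INR (S n) * M ^ 2) * Cmod z ^ n) by ring.
      replace (Cmod h ^ 2 * INR (S n) * M ^ S (S n))
        with ((Cmod h ^ 2 * INR (S n) * M ^ 2) * M ^ n) by (simpl; ring).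
      apply Rmult_le_compat_l; [|easy].
      pose proof (pos_INR (S n)). apply Rmult_le_pos; [apply Rmult_le_pos|]; try easy;
      apply pow_le; lra. }
    rewrite E.
    apply Rle_trans with (M ^ 2 * (Cmod (z + h)%C * Cmod (taylor2 n z h)
        + Cmod (INR n * (h * h) * z ^ pred n)%C)).
    { apply Rmult_le_compat_l; [apply pow_le; lra|].
      eapply Rle_trans; [apply Cmod_triangle|]. rewrite Cmod_mult. apply Rle_refl. }
    assert (B2 : Cmod (z + h)%C * (M ^ 2 * Cmod (taylor2 n z h))
      <= M * (Cmod h ^ 2 * INR n ^ 2 * M ^ n)).
    { apply Rmult_le_compat; try easy; [apply Cmod_ge_0|].
      apply Rmult_le_pos; [apply pow_le; lra | apply Cmod_ge_0]. }
    rewrite S_INR.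
    assert (0 <= Cmod h ^ 2 * (M ^ S n)).
    { apply Rmult_le_pos; apply pow_le; lra. }
    pose proof (pos_INR n).
    replace (M * (Cmod h ^ 2 * INR n ^ 2 * M ^ n)) with (Cmod h ^ 2 * M ^ S n * INR n ^ 2) in B2 by (simpl; ring).
    replace (Cmod h ^ 2 * INR n * M ^ S n) with (Cmod h ^ 2 * M ^ S n * INR n) in B by ring.
    replace (Cmod h ^ 2 * (INR n + 1) ^ 2 * M ^ S n) with (Cmod h ^ 2 * M ^ S n * (INR n + 1)^2) by ring.
    nra.
Qed.

Lemma is_derive_C_quadratic (f : C -> C) (z l : C) (d K : R) :
  0 < d -> 0 <= K ->
  (forall h, Cmod h < d -> Cmod (f (z + h) - f z - h * l)%C <= K * Cmod h ^ 2) ->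
  is_derive (K := C_AbsRing) (V := C_NormedModule) f z l.
Proof.
  intros Hd HK H. split.
  - apply (is_linear_scal_l (K := C_AbsRing) (V := C_NormedModule)).
  - intros x Hx.
    assert (x = z) as ->.
    { symmetry. now apply (is_filter_lim_locally_unique (K := C_AbsRing) (V := AbsRing_NormedModule C_AbsRing)). }
    intros eps.
    (* K may be 0, hence the division by K + 1. *)
    assert (He : 0 < Rmin d (eps / (K + 1))).
    { apply Rmin_pos; [easy|]. apply Rdiv_lt_0_compat; [apply cond_pos | lra]. }
    exists (mkposreal _ He). intros y. change C in y. intros Hy.
    change (Cmod (y - z) < Rmin d (eps / (K + 1))) in Hy.
    assert (H1 : Cmod (y - z) < d) by (eapply Rlt_le_trans; [exact Hy | apply Rmin_l]).
    assert (H2 : Cmod (y - z) < eps / (K + 1)) by (eapply Rlt_le_trans; [exact Hy | apply Rmin_r]).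
    change (Cmod (f y - f z - (y - z) * l) <= eps * Cmod (y - z)).
    specialize (H (y - z)%C H1). replace (z + (y - z))%C with y in H by ring.
    eapply Rle_trans; [exact H|]. pose proof (Cmod_ge_0 (y - z)).
    replace (K * Cmod (y - z) ^ 2) with (K * Cmod (y - z) * Cmod (y - z)) by ring.
    apply Rmult_le_compat_r; [easy|].
    apply Rmult_lt_compat_r with (r := K + 1) in H2; [|lra].
    unfold Rdiv in H2. rewrite Rmult_assoc, Rinv_l in H2 by lra. nra.
Qed.

(** The remainder of the series is the sum of the remainders a_n [taylor2], so it is at most |h|^2 /
    M^2 times the sum of n^2 |a_n| M^n. This is finite for M midway between |z| and 1, as [rad1]
    survives multiplication by n. *)
Lemma is_derive_CPS (a : nat -> R) (z : C) :
  rad1 a -> Cmod z < 1 ->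
  is_derive (K := C_AbsRing) (V := C_NormedModule) (CPS a) z (CPS (PS_derive a) z).
Proof.
  intros Ha Hz. pose proof (Cmod_ge_0 z) as Hz0.
  set (M := (1 + Cmod z) / 2). assert (HM : Cmod z < M < 1) by (unfold M; lra).
  assert (HS : ex_series (fun n => Rabs (INR n * (INR n * a n)) * M ^ n)).
  { apply rad1_mult_INR; [now apply rad1_mult_INR | lra]. }
  assert (HS0 : 0 <= Series (fun n => Rabs (INR n * (INR n * a n)) * M ^ n)).
  { eapply Rle_trans; [|apply (sum_n_le_Series _ 0); [|exact HS]].
    - rewrite sum_O. simpl. rewrite Rmult_0_l, Rabs_R0. lra.
    - intros k. apply Rmult_le_pos; [apply Rabs_pos | apply pow_le; lra]. }
  apply is_derive_C_quadratic with (d := M - Cmod z)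
    (K := / M ^ 2 * Series (fun n => Rabs (INR n * (INR n * a n)) * M ^ n)); [lra| |].
  { apply Rmult_le_pos; [|easy]. left. apply Rinv_0_lt_compat, pow_lt. lra. }
  intros h Hh.
  assert (Hzh : Cmod (z + h)%C < M).
  { eapply Rle_lt_trans; [apply Cmod_triangle|]. lra. }
  assert (B : forall n, Cmod (a n * taylor2 n z h)%C
     <= / M ^ 2 * Cmod h ^ 2 * (Rabs (INR n * (INR n * a n)) * M ^ n)).
  { intros n. rewrite Cmod_mult, Cmod_R, !Rabs_mult, (Rabs_pos_eq (INR n)) by apply pos_INR.
    pose proof (Cmod_taylor2 n z h M ltac:(lra) ltac:(lra) ltac:(lra)) as E.
    assert (0 < M ^ 2) by (apply pow_lt; lra).
    apply Rmult_le_reg_l with (M ^ 2); [easy|].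
    replace (M ^ 2 * (/ M ^ 2 * Cmod h ^ 2 * (INR n * (INR n * Rabs (a n)) * M ^ n)))
      with (Rabs (a n) * (Cmod h ^ 2 * INR n ^ 2 * M ^ n)) by (field; lra).
    replace (M ^ 2 * (Rabs (a n) * Cmod (taylor2 n z h)))
      with (Rabs (a n) * (M ^ 2 * Cmod (taylor2 n z h))) by ring.
    apply Rmult_le_compat_l; [apply Rabs_pos | easy]. }
  assert (X := ex_series_Rscal (/ M ^ 2 * Cmod h ^ 2) _ HS).
  assert (XT := abs_summable_le _ _ B X).
  assert (E : (CPS a (z + h) - CPS a z - h * CPS (PS_derive a) z)%C
      = CSeries (fun n => a n * taylor2 n z h)%C).
  { assert (X1 : abs_summable (fun n => a n * (z + h) ^ n)%C) by (apply rad1_terms; [easy | lra]).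
    assert (X2 : abs_summable (fun n => a n * z ^ n)%C) by now apply rad1_terms.
    assert (X3 : abs_summable (fun n => PS_derive a n * z ^ n)%C).
    { apply rad1_terms; [now apply rad1_derive | easy]. }
    assert (X4 : abs_summable (fun n => a n * (INR n * z ^ pred n))%C).
    { apply (ex_series_incr_1 (V := R_NormedModule)). revert X3. apply ex_series_Rext.
      intros n. unfold PS_derive. f_equal. rewrite RtoC_mult. simpl pred. ring. }
    (* The term n = 0, where [pred n] is a truncated exponent, is killed by [INR 0]; shifting the
       index gives the derived series. *)
    assert (E4 : CPS (PS_derive a) z = CSeries (fun n => a n * (INR n * z ^ pred n))%C).
    { rewrite (CSeries_shift _ X4). simpl (INR 0). rewrite Cmult_0_l, Cmult_0_r, Cplus_0_l.
      apply CSeries_ext. intros n. unfold PS_derive. rewrite RtoC_mult. simpl pred. ring. }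
    rewrite E4. unfold CPS.
    transitivity (CSeries (fun n => a n * (z + h) ^ n)
       + ((- (1)) * CSeries (fun n => a n * z ^ n)
         + (- h) * CSeries (fun n => a n * (INR n * z ^ pred n))))%C; [ring|].
    rewrite <- !CSeries_scal by easy.
    rewrite <- !CSeries_plus; try easy; repeat apply abs_summable_plus; try now apply abs_summable_scal.
    apply CSeries_ext. intros n. unfold taylor2. ring. }
  rewrite E. eapply Rle_trans; [now apply Cmod_CSeries|].
  eapply Rle_trans; [apply Series_le; [|exact X]|].
  - intros n. split; [apply Cmod_ge_0 | apply B].
  - rewrite Series_scal_l. apply Req_le. ring.
Qed.

(** Coefficient sequences of functions in T, with the minus sign kept inside a. Positive multipliers
    equal to 1 at index 1 preserve the first three conditions, so the denominator in the class Q is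
    of the same kind. *)
Definition normalized (a : nat -> R) : Prop :=
  a 0%nat = 0 /\ a 1%nat = 1 /\ (forall k, a (S (S k)) <= 0) /\ rad1 a.

Lemma Series_zero : Series (fun _ => 0) = 0.
Proof.
  transitivity (Series (fun _ => 0 * 0)).
  - apply Series_ext. intros. ring.
  - rewrite (Series_scal_l 0 (fun _ => 0)). ring.
Qed.

Lemma CSeries_RtoC (u : nat -> R) : CSeries (fun n => RtoC (u n)) = RtoC (Series u).
Proof. unfold CSeries, RtoC. simpl. now rewrite Series_zero. Qed.

Lemma CPS_0 (a : nat -> R) : rad1 a -> CPS a 0 = a 0%nat.
Proof.
  intros Ha. unfold CPS. rewrite CSeries_shift.
  - rewrite (CSeries_ext _ (fun _ => RtoC 0)), CSeries_RtoC, Series_zero.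
    + simpl. ring.
    + intros n. rewrite Cpow_S. ring.
  - apply rad1_terms; [easy|]. rewrite Cmod_0. lra.
Qed.

Lemma CPS_tail (a : nat -> R) (z : C) :
  a 0%nat = 0 -> a 1%nat = 1 -> rad1 a -> Cmod z < 1 ->
  CPS a z = (z + CSeries (fun k => a (S (S k)) * z ^ S (S k)))%C.
Proof.
  intros H0 H1 Ha Hz. pose proof (rad1_terms a z Ha Hz) as X.
  unfold CPS. rewrite (CSeries_shift _ X).
  rewrite (CSeries_shift _ (abs_summable_shift _ X)).
  rewrite H0, H1. simpl (z ^ 0)%C. rewrite Cpow_1_r. ring.
Qed.

(** Splits off the zero at the origin, so that z cancels in z g'/g. *)
Lemma CPS_factor (a : nat -> R) (z : C) :
  a 0%nat = 0 -> a 1%nat = 1 -> rad1 a -> Cmod z < 1 ->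
  CPS a z = (z * (1 + CSeries (fun k => a (S (S k)) * z ^ S k)))%C.
Proof.
  intros H0 H1 Ha Hz. rewrite CPS_tail by easy.
  rewrite (CSeries_ext _ (fun k => z * (a (S (S k)) * z ^ S k))%C).
  - rewrite CSeries_scal; [ring|].
    exact (abs_summable_shift _ (rad1_terms _ z (rad1_shift _ Ha) Hz)).
  - intros k. rewrite (Cpow_S z (S k)). ring.
Qed.

(** * Functions given by a power series on the disc only *)

Lemma locally_disc (z : C) :
  Cmod z < 1 -> locally (T := AbsRing_UniformSpace C_AbsRing) z (fun t => Cmod t < 1).
Proof.
  intros Hz. assert (H : 0 < 1 - Cmod z) by lra.
  exists (mkposreal _ H). intros y. change C in y. intros Hy.
  change (Cmod (y - z) < 1 - Cmod z) in Hy.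
  pose proof (Cmod_triangle (y - z) z) as T. replace (y - z + z)%C with y in T by ring. lra.
Qed.

(** Derivatives are local and the disc is open, so the values of f outside it do not matter. *)
Lemma is_derive_on_disc (f : C -> C) (a : nat -> R) :
  rad1 a -> (forall z, Cmod z < 1 -> f z = CPS a z) ->
  forall z, Cmod z < 1 ->
  is_derive (K := C_AbsRing) (V := C_NormedModule) f z (CPS (PS_derive a) z).
Proof.
  intros Ha Hf z Hz. apply (is_derive_ext_loc (V := C_NormedModule)) with (CPS a).
  - generalize (locally_disc z Hz). apply filter_imp. intros y Hy. symmetry. now apply Hf.
  - now apply is_derive_CPS.
Qed.

Lemma C_derive_on_disc (f : C -> C) (a : nat -> R) :
  rad1 a -> (forall z, Cmod z < 1 -> f z = CPS a z) ->
  forall z, Cmod z < 1 -> C_derive f z = CPS (PS_derive a) z.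
Proof.
  intros Ha Hf z Hz. apply is_C_derive_unique. now apply is_derive_on_disc.
Qed.

Lemma rad1_iter_derive (a : nat -> R) (n : nat) :
  rad1 a -> rad1 (Nat.iter n PS_derive a).
Proof. intros Ha. induction n; [easy | now apply rad1_derive]. Qed.

Lemma C_derive_n_on_disc (f : C -> C) (a : nat -> R) (n : nat) :
  rad1 a -> (forall z, Cmod z < 1 -> f z = CPS a z) ->
  forall z, Cmod z < 1 -> C_derive_n n f z = CPS (Nat.iter n PS_derive a) z.
Proof.
  intros Ha Hf. induction n as [|n IH]; [exact Hf|].
  apply C_derive_on_disc; [now apply rad1_iter_derive | exact IH].
Qed.

Lemma iter_PS_derive (a : nat -> R) (n k : nat) :
  Nat.iter n PS_derive a k * INR (fact k) = INR (fact (n + k)) * a (n + k)%nat.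
Proof.
  revert k. induction n as [|n IH]; intros k.
  - simpl. ring.
  - simpl Nat.iter. unfold PS_derive at 1.
    replace (S n + k)%nat with (n + S k)%nat by lia. rewrite <- IH.
    rewrite fact_simpl, mult_INR. ring.
Qed.

(** At 0 only the constant coefficient n! a_n of the n-th derived series survives. This connects the
    derivatives inside [Upsilon] with the series of phi. *)
Lemma taylor_coef_on_disc (f : C -> C) (a : nat -> R) (n : nat) :
  rad1 a -> (forall z, Cmod z < 1 -> f z = CPS a z) -> taylor_coef f n = a n.
Proof.
  intros Ha Hf. unfold taylor_coef.
  rewrite (C_derive_n_on_disc f a n Ha Hf) by (rewrite Cmod_0; lra).
  rewrite CPS_0 by now apply rad1_iter_derive.
  pose proof (iter_PS_derive a n 0) as E. rewrite Nat.add_0_r in E. simpl (INR (fact 0)) in E.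
  rewrite Rmult_1_r in E. rewrite E, RtoC_mult. field.
  intros H. apply RtoC_inj in H. now apply INR_fact_neq_0 in H.
Qed.

Definition neg_coef (c : nat -> R) (n : nat) : R :=
  match n with 0%nat => 0 | 1%nat => 1 | _ => - c n end.

(** At a real point r in (0,1) the given series has nonnegative terms, so its convergence there is
    absolute convergence on |z| = r, which yields [rad1]. *)
Lemma neg_coef_CPS (phi : C -> C) (c : nat -> R) :
  (forall nu : nat, (2 <= nu)%nat -> 0 <= c nu) ->
  (forall z : C, in_disc z ->
      is_series (K := C_AbsRing) (V := C_NormedModule)
        (fun k : nat => (c (k + 2)%nat * z ^ (k + 2))%C) (z - phi z)%C) ->
  normalized (neg_coef c) /\ forall z, Cmod z < 1 -> phi z = CPS (neg_coef c) z.
Proof.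
  intros Hc Hs. set (a := neg_coef c).
  assert (Ha : rad1 a).
  { apply rad1_pos. intros r Hr.
    apply (ex_series_incr_n (V := R_NormedModule) _ 2).
    assert (Hr1 : in_disc r) by (unfold in_disc; rewrite Cmod_R, Rabs_pos_eq; lra).
    specialize (Hs r Hr1). apply is_series_C_components in Hs. destruct Hs as [Hs _].
    assert (X : ex_series (fun k => Re (c (k + 2)%nat * RtoC r ^ (k + 2)))%C) by (eexists; exact Hs).
    revert X. apply ex_series_Rext. intros n.
    rewrite <- RtoC_pow, <- RtoC_mult, re_RtoC. rewrite (Nat.add_comm n 2). f_equal.
    simpl. rewrite Rabs_Ropp, Rabs_pos_eq; [easy|]. apply (Hc (S (S n))). lia. }
  split.
  - split; [easy|]. split; [easy|]. split; [|easy].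
    intros k. simpl. specialize (Hc (S (S k)) ltac:(lia)). lra.
  - intros z Hz. rewrite CPS_tail by easy.
    specialize (Hs z Hz).
    pose proof (CSeries_unique _ _ Hs) as E.
    rewrite (CSeries_ext _ (fun k => (- (1)) * (c (k + 2)%nat * z ^ (k + 2)))%C).
    + rewrite CSeries_scal; [rewrite E; ring|].
      apply (ex_series_Rext (fun k => Cmod (a (S (S k)) * z ^ S (S k))%C)).
      * intros k. rewrite !Cmod_mult, (Nat.add_comm k 2). simpl (a _).
        now rewrite RtoC_opp, Cmod_opp.
      * exact (abs_summable_shift _ (abs_summable_shift _ (rad1_terms a z Ha Hz))).
    + intros k. rewrite (Nat.add_comm k 2). simpl (a _). rewrite RtoC_opp. simpl (2 + k)%nat. ring.
Qed.

(** * The coefficients of the class Q *)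

(** The sum form of [n] in recursive shape; positivity and the bound [n] <= n follow from it by
    induction. *)
Lemma pq_number_S (p q : R) (n : nat) :
  p <> q -> pq_number p q (S n) = p * pq_number p q n + q ^ n.
Proof. intros H. unfold pq_number. simpl. field. lra. Qed.

Lemma pq_number_0 (p q : R) : pq_number p q 0 = 0.
Proof. unfold pq_number, Rdiv. simpl. ring. Qed.

Lemma pq_number_1 (p q : R) : p <> q -> pq_number p q 1 = 1.
Proof. intros H. rewrite pq_number_S, pq_number_0 by easy. simpl. ring. Qed.

Lemma pq_number_bounds (p q : R) (n : nat) :
  0 < p -> p < q -> q <= 1 -> 0 <= pq_number p q n <= INR n.
Proof.
  intros Hp Hpq Hq. induction n as [|n IH].
  - rewrite pq_number_0. simpl. lra.
  - rewrite pq_number_S, S_INR by lra.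
    assert (0 < q ^ n) by (apply pow_lt; lra).
    assert (q ^ n <= 1) by (apply pow_le_1; lra).
    nra.
Qed.

Lemma pq_number_pos (p q : R) (n : nat) :
  0 < p -> p < q -> q <= 1 -> 0 < pq_number p q (S n).
Proof.
  intros Hp Hpq Hq. rewrite pq_number_S by lra.
  pose proof (pq_number_bounds p q n Hp Hpq Hq).
  assert (0 < q ^ n) by (apply pow_lt; lra). nra.
Qed.

Definition weight (p q tau : R) (xi kappa n : nat) : R :=
  pq_number p q n ^ kappa * (1 + (INR n - 1) * tau) ^ xi.

Lemma weight_1 (p q tau : R) (xi kappa : nat) :
  p <> q -> weight p q tau xi kappa 1 = 1.
Proof.
  intros H. unfold weight. rewrite pq_number_1 by easy. simpl (INR 1).
  replace (1 + (1 - 1) * tau) with 1 by ring. rewrite !pow1. ring.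
Qed.

Lemma weight_pos (p q tau : R) (xi kappa n : nat) :
  0 < p -> p < q -> q <= 1 -> 0 <= tau -> 0 < weight p q tau xi kappa (S n).
Proof.
  intros Hp Hpq Hq Ht. unfold weight. apply Rmult_lt_0_compat; apply pow_lt.
  - now apply pq_number_pos.
  - rewrite S_INR. pose proof (pos_INR n). nra.
Qed.

Lemma weight_S (p q tau : R) (xi kappa n : nat) :
  weight p q tau xi (S kappa) n = pq_number p q n * weight p q tau xi kappa n.
Proof. unfold weight. simpl. ring. Qed.

Lemma rad1_pow_mult (w a : nat -> R) (M : R) (m : nat) :
  (forall n, Rabs (w n) <= M * (INR n + 1)) -> rad1 a ->
  rad1 (fun n => w n ^ m * a n).
Proof.
  intros Hw Ha. induction m as [|m IH].
  - revert Ha. apply rad1_ext. intros n. simpl. ring.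
  - apply (rad1_ext (fun n => w n * (w n ^ m * a n))).
    + intros n. simpl. ring.
    + now apply rad1_mult with M.
Qed.

Lemma rad1_weight (p q tau : R) (xi kappa : nat) (a : nat -> R) :
  0 < p -> p < q -> q <= 1 -> 0 <= tau -> rad1 a ->
  rad1 (fun n => weight p q tau xi kappa n * a n).
Proof.
  intros Hp Hpq Hq Ht Ha.
  apply (rad1_ext (fun n => pq_number p q n ^ kappa * ((1 + (INR n - 1) * tau) ^ xi * a n))).
  { intros n. unfold weight. ring. }
  apply rad1_pow_mult with 1.
  - intros n. pose proof (pq_number_bounds p q n Hp Hpq Hq).
    rewrite Rabs_pos_eq; lra.
  (* At n = 0 the multiplier is 1 - tau, possibly negative, so the bound has to be two-sided. *)
  - apply rad1_pow_mult with (1 + tau); [|easy]. intros n. pose proof (pos_INR n).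
    apply Rabs_le. nra.
Qed.

Lemma rad1_factor (p q tau : R) (a : nat -> R) :
  0 < p -> p < q -> q <= 1 -> 0 <= tau -> rad1 a ->
  rad1 (fun n => factor p q tau n * a n).
Proof.
  intros Hp Hpq Hq Ht. apply rad1_mult with (1 + tau). intros n.
  pose proof (pq_number_bounds p q n Hp Hpq Hq). unfold factor.
  apply Rabs_le. split; nra.
Qed.

Lemma Upsilon_on_disc (p q tau : R) (xi kappa : nat) (phi : C -> C) (a : nat -> R) (z : C) :
  0 < p -> p < q -> q <= 1 -> 0 <= tau -> normalized a ->
  (forall z, Cmod z < 1 -> phi z = CPS a z) -> Cmod z < 1 ->
  Upsilon p q tau xi kappa phi z = CPS (fun n => weight p q tau xi kappa n * a n) z.
Proof.
  intros Hp Hpq Hq Ht (H0 & H1 & _ & Ha) Hphi Hz.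
  rewrite CPS_tail; [|rewrite H0; ring | rewrite weight_1, H1; lra | now apply rad1_weight | easy].
  unfold Upsilon. f_equal. apply CSeries_ext. intros k.
  rewrite (taylor_coef_on_disc phi a _ Ha Hphi). rewrite (Nat.add_comm k 2).
  rewrite <- RtoC_mult. reflexivity.
Qed.

(* The coefficients of the denominator in class_Q, for phi with coefficients a. *)
Definition qcoef (p q tau : R) (xi kappa : nat) (a : nat -> R) (n : nat) : R :=
  factor p q tau n * (weight p q tau xi kappa n * a n).

Lemma qcoef_normalized (p q tau : R) (xi kappa : nat) (a : nat -> R) :
  0 < p -> p < q -> q <= 1 -> 0 <= tau ->
  (forall nu : nat, (2 <= nu)%nat -> 0 < factor p q tau nu) ->
  normalized a -> normalized (qcoef p q tau xi kappa a).
Proof.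
  intros Hp Hpq Hq Ht Hf (H0 & H1 & H2 & Ha). unfold qcoef. repeat split.
  - rewrite H0. ring.
  - rewrite weight_1, H1 by lra. unfold factor. rewrite pq_number_1 by lra. ring.
  - intros k. specialize (H2 k). specialize (Hf (S (S k)) ltac:(lia)).
    pose proof (weight_pos p q tau xi kappa (S k) Hp Hpq Hq Ht) as Hw.
    assert (weight p q tau xi kappa (S (S k)) * a (S (S k)) <= 0) by nra. nra.
  - apply rad1_factor; try easy. now apply rad1_weight.
Qed.

(** Raising kappa by one multiplies the weight by [n], and (1 - tau) + tau [n] is [factor]; z times
    the derivative multiplies the n-th coefficient by n. Hence the quotient is z g'/g for the g with
    coefficients b. *)
Lemma class_Q_iff (p q tau eta : R) (xi kappa : nat) (phi : C -> C) (a : nat -> R) :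
  0 < p -> p < q -> q <= 1 -> 0 <= tau -> normalized a ->
  (forall z, Cmod z < 1 -> phi z = CPS a z) ->
  let b := qcoef p q tau xi kappa a in
  class_Q p q tau eta xi kappa phi <->
  class_A phi /\ forall z, Cmod z < 1 -> z <> 0 ->
    CPS b z <> 0 /\ Re (CPS (fun n => INR n * b n)%R z / CPS b z)%C > eta.
Proof.
  intros Hp Hpq Hq Ht Hn Hphi b.
  assert (Ha : rad1 a) by apply Hn.
  set (w0 := fun n => weight p q tau xi kappa n * a n).
  set (w1 := fun n => weight p q tau xi (S kappa) n * a n).
  assert (R0 : rad1 w0) by now apply rad1_weight.
  assert (R1 : rad1 w1) by now apply rad1_weight.
  assert (U0 : forall z, Cmod z < 1 -> Upsilon p q tau xi kappa phi z = CPS w0 z)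
    by (intros; now apply Upsilon_on_disc).
  assert (U1 : forall z, Cmod z < 1 -> Upsilon p q tau xi (S kappa) phi z = CPS w1 z)
    by (intros; now apply Upsilon_on_disc).
  assert (Comb : forall u v r z, rad1 u -> rad1 v -> Cmod z < 1 ->
     (forall n, r n = (1 - tau) * u n + tau * v n) ->
     ((1 - tau)%R * CPS u z + tau * CPS v z)%C = CPS r z).
  { intros u v r z Hu Hv Hz Hr. unfold CPS.
    apply (rad1_terms u z) in Hu; [|easy]. apply (rad1_terms v z) in Hv; [|easy].
    rewrite <- !CSeries_scal by easy.
    rewrite <- CSeries_plus by now apply abs_summable_scal.
    apply CSeries_ext. intros n. rewrite Hr, RtoC_plus, !RtoC_mult. ring. }
  assert (Den : forall z, Cmod z < 1 ->
    ((1 - tau)%R * Upsilon p q tau xi kappa phi z + tau * Upsilon p q tau xi (S kappa) phi z)%C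
    = CPS b z).
  { intros z Hz. rewrite U0, U1 by easy. apply Comb; try easy.
    intros n. unfold b, qcoef, w0, w1, factor. rewrite weight_S. ring. }
  assert (Num : forall z, Cmod z < 1 ->
    ((1 - tau)%R * z * C_derive (Upsilon p q tau xi kappa phi) z
      + tau * z * C_derive (Upsilon p q tau xi (S kappa) phi) z)%C
    = CPS (fun n => INR n * b n)%R z).
  { intros z Hz. rewrite (C_derive_on_disc _ w0 R0 U0), (C_derive_on_disc _ w1 R1 U1) by easy.
    rewrite <- !Cmult_assoc, !mult_CPS_derive by easy.
    apply Comb; try easy; try now apply rad1_mult_INR.
    intros n. unfold b, qcoef, w0, w1, factor. rewrite weight_S. ring. }
  unfold class_Q, in_disc. split; intros [HA H]; split; try easy;
    intros z Hz Hz0; specialize (H z Hz Hz0); cbv zeta in *;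
    [rewrite Den, Num in H by easy | rewrite Den, Num by easy]; exact H.
Qed.

(** * Starlikeness and coefficients *)

Lemma Re_div_gt (u v : C) (alpha : R) :
  v <> 0 -> Cmod (u - v) < (1 - alpha) * Cmod v -> Re (u / v)%C > alpha.
Proof.
  intros Hv H. apply Cmod_gt_0 in Hv as Hv'.
  replace (u / v)%C with (1 + (u - v) / v)%C by (field; easy).
  pose proof (re_le_Cmod ((u - v) / v)) as B. rewrite Cmod_div in B by easy.
  assert (Cmod (u - v) / Cmod v < 1 - alpha).
  { apply Rmult_lt_reg_r with (Cmod v); [easy|]. unfold Rdiv.
    rewrite Rmult_assoc, Rinv_l by lra. lra. }
  assert (Rabs (Re ((u - v) / v)) < 1 - alpha) as E by lra.
  apply Rabs_def2 in E. simpl in *. lra.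
Qed.

(* With A = sum |b_n| t^(n-1) and B = sum (n-1) |b_n| t^(n-1), the hypothesis
   reads B + (1-alpha) A <= M < 1-alpha, while |g/z| >= 1-A and
   |g' - g/z| <= B. *)
Lemma starlike_of_coef (b : nat -> R) (alpha M : R) (z : C) :
  normalized b -> 0 <= alpha < 1 -> M < 1 - alpha -> Cmod z < 1 -> z <> 0 ->
  (forall N, sum_n (fun k => (INR (S (S k)) - alpha) * (- b (S (S k))) * Cmod z ^ S k) N <= M) ->
  CPS b z <> 0 /\ Re (CPS (fun n => INR n * b n)%R z / CPS b z)%C > alpha.
Proof.
  intros (H0 & H1 & H2 & Hb) Hal HM Hz Hz0 HN.
  set (t := Cmod z) in *. assert (Ht : 0 <= t) by apply Cmod_ge_0.
  assert (Hnb := rad1_mult_INR b Hb).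
  pose (ua := fun k => - b (S (S k)) * t ^ S k).
  pose (ub := fun k => INR (S k) * (- b (S (S k))) * t ^ S k).
  assert (Pa : forall k, 0 <= ua k).
  { intros k. apply Rmult_le_pos; [specialize (H2 k); lra | now apply pow_le]. }
  assert (Pb : forall k, 0 <= ub k).
  { intros k. unfold ub. rewrite Rmult_assoc.
    apply Rmult_le_pos; [apply pos_INR | apply Pa]. }
  set (s1 := fun k => (b (S (S k)) * z ^ S k)%C).
  set (s2 := fun k => ((INR (S (S k)) * b (S (S k)))%R * z ^ S k)%C).
  assert (S1 : abs_summable s1)
    by exact (abs_summable_shift _ (rad1_terms _ z (rad1_shift _ Hb) Hz)).
  assert (S2 : abs_summable s2)
    by exact (abs_summable_shift _ (rad1_terms _ z (rad1_shift _ Hnb) Hz)).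
  assert (M1 : forall k, Cmod (s1 k) = ua k).
  { intros k. unfold s1, ua. rewrite Cmod_mult, Cmod_R, Cmod_pow.
    rewrite Rabs_left1 by apply H2. reflexivity. }
  assert (M2 : forall k, Cmod (s2 k + (- (1)) * s1 k)%C = ub k).
  { intros k. unfold s1, s2, ub.
    replace (_ + _)%C with (- RtoC (INR (S k)) * (- b (S (S k)))%R * z ^ S k)%C.
    - rewrite !Cmod_mult, Cmod_opp, !Cmod_R, Cmod_pow, !Rabs_pos_eq; [reflexivity| |apply pos_INR].
      specialize (H2 k). lra.
    - rewrite (S_INR (S k)), RtoC_mult, RtoC_plus, RtoC_opp. ring. }
  assert (S3 : abs_summable (fun k => s2 k + (- (1)) * s1 k)%C)
    by (apply abs_summable_plus; [|apply abs_summable_scal]; easy).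
  assert (Ea : ex_series ua) by (revert S1; apply ex_series_Rext, M1).
  assert (Eb : ex_series ub) by (revert S3; apply ex_series_Rext, M2).
  assert (BA : Series ub + (1 - alpha) * Series ua <= M).
  { rewrite <- Series_scal_l, <- Series_plus by (try apply ex_series_Rscal; easy).
    apply Series_le_bound.
    - apply (ex_series_plus (V := R_NormedModule)); [easy | now apply ex_series_Rscal].
    - intros N. eapply Rle_trans; [apply Req_le | apply (HN N)].
      apply sum_n_Rext. intros k. unfold ua, ub. rewrite (S_INR (S k)). ring. }
  assert (B0 : 0 <= Series ub) by (eapply Rle_trans; [|apply (sum_n_le_Series ub 0 Pb Eb)]; rewrite sum_O; apply Pb).
  pose proof (Cmod_CSeries _ S1) as C1. rewrite (Series_ext _ _ M1) in C1.
  pose proof (Cmod_CSeries _ S3) as C3. cbv beta in C3. rewrite (Series_ext _ _ M2) in C3.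
  rewrite CSeries_plus, CSeries_scal in C3; [|easy|easy|now apply abs_summable_scal].
  set (sa := CSeries s1) in *. set (sb := CSeries s2) in *.
  assert (G : Cmod (1 + sa)%C >= 1 - Series ua).
  { pose proof (Cmod_triangle (1 + sa) (- sa)) as T. rewrite Cmod_opp in T.
    replace (1 + sa + - sa)%C with (RtoC 1) in T by ring. rewrite Cmod_1 in T. lra. }
  (* B >= 0 and (1 - alpha) A <= M < 1 - alpha force A < 1, which keeps g/z away from 0. *)
  assert (A1 : Series ua < 1) by nra.
  assert (Hg : (1 + sa)%C <> 0) by (apply Cmod_gt_0; lra).
  rewrite CPS_factor by easy.
  rewrite (CPS_factor (fun n => INR n * b n)); [|rewrite H0; ring|rewrite H1; simpl; ring|easy|easy].
  fold s1 s2 sa sb. split; [now apply Cmult_neq_0|].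
  replace (z * (1 + sb) / (z * (1 + sa)))%C with ((1 + sb) / (1 + sa))%C by (field; split; easy).
  apply Re_div_gt; [easy|].
  (* The chain is B <= M - (1 - alpha) A < (1 - alpha)(1 - A) <= (1 - alpha) |1 + sa|. *)
  replace (1 + sb - (1 + sa))%C with (sb + (- (1)) * sa)%C by ring. nra.
Qed.

(** * The real axis and the necessary coefficient condition *)

Lemma CPS_RtoC (a : nat -> R) (x : R) : CPS a x = RtoC (PSeries a x).
Proof.
  unfold CPS, PSeries. rewrite <- CSeries_RtoC. apply CSeries_ext. intros n.
  now rewrite RtoC_mult, RtoC_pow.
Qed.

Lemma rad1_CV_radius (a : nat -> R) (x : R) :
  rad1 a -> Rabs x < 1 -> Rbar_lt (Rabs x) (CV_radius a).
Proof.
  intros Ha Hx. pose proof (Rabs_pos x). set (s := (1 + Rabs x) / 2).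
  apply Rbar_lt_le_trans with s; [simpl; unfold s; lra|].
  apply (proj1 (Lub_Rbar_correct (CV_disk a))).
  unfold CV_disk. apply (ex_series_Rext (fun n => Rabs (a n) * s ^ n)).
  - intros n. rewrite Rabs_mult, (Rabs_pos_eq (s ^ n)); [easy|]. apply pow_le. unfold s. lra.
  - apply Ha. unfold s. lra.
Qed.

Lemma ex_series_PS (a : nat -> R) (x : R) :
  rad1 a -> 0 <= x < 1 -> ex_series (fun n => a n * x ^ n).
Proof.
  intros Ha Hx. apply ex_series_Rle with (2 := Ha x Hx). intros n.
  rewrite Rabs_mult, (Rabs_pos_eq (x ^ n)); [lra|]. apply pow_le. lra.
Qed.

(** Dividing by x gives a continuous h with h(0) = 1; a nonpositive value would produce a zero by
    the intermediate value theorem. The sign lets the inequality for the quotient be multiplied by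
    its denominator. *)
Lemma PSeries_positive (b : nat -> R) :
  b 0%nat = 0 -> b 1%nat = 1 -> rad1 b ->
  (forall x, 0 < x < 1 -> PSeries b x <> 0) ->
  forall x, 0 < x < 1 -> 0 < PSeries b x.
Proof.
  intros H0 H1 Hb Hnz x Hx.
  set (h := PSeries (fun n => b (S n))).
  assert (Hd : forall y, 0 <= y < 1 -> PSeries b y = y * h y).
  { intros y Hy. rewrite PSeries_decr_1.
    - rewrite H0. unfold h. rewrite Rplus_0_l. f_equal.
    - apply ex_pseries_R. now apply ex_series_PS. }
  assert (Hc : forall y, 0 <= y < 1 -> continuity_pt h y).
  { intros y Hy. apply continuity_pt_filterlim.
    apply (ex_derive_continuous (K := R_AbsRing) (V := R_NormedModule)).
    apply ex_derive_PSeries, rad1_CV_radius; [now apply rad1_shift|].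
    rewrite Rabs_pos_eq; lra. }
  assert (Hh0 : h 0 = 1) by (unfold h; rewrite PSeries_0; exact H1).
  rewrite Hd by lra. apply Rmult_lt_0_compat; [lra|].
  destruct (Rlt_le_dec 0 (h x)) as [|Hneg]; [easy|]. exfalso.
  assert (Hx' : h x <> 0).
  { intros E. apply (Hnz x Hx). rewrite Hd, E by lra. ring. }
  destruct (IVT_Rbar_decr h 0 x (h 0) (h x) 0) as [y (Hy1 & Hy2 & Hy)].
  - apply is_lim_continuity, Hc. lra.
  - apply is_lim_continuity, Hc. lra.
  - simpl. intros y Hy1 Hy2. apply Hc. lra.
  - simpl. lra.
  - simpl. lra.
  - simpl in Hy1, Hy2. apply (Hnz y); [lra|]. rewrite Hd, Hy by lra. ring.
Qed.

Lemma pow_ge_bernoulli (x : R) (m : nat) :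
  0 <= x <= 1 -> 1 - INR m * (1 - x) <= x ^ m.
Proof.
  intros Hx. induction m as [|m IH].
  - simpl. lra.
  - rewrite S_INR. simpl. assert (x ^ m <= 1) by (apply pow_le_1; lra).
    nra.
Qed.

(** The passage x -> 1, made explicit by Bernoulli's inequality. For s <= 0 already x^m s >= s at x
    = 1/2. *)
Lemma le_of_pow_mult_le (m : nat) (s c : R) :
  (forall x, 0 < x < 1 -> x ^ m * s <= c) -> s <= c.
Proof.
  intros H. destruct (Rle_lt_dec s 0) as [Hs|Hs].
  { assert (Hx : 0 < 1 / 2 < 1) by lra. specialize (H _ Hx).
    assert ((1 / 2) ^ m <= 1) by (apply pow_le_1; lra).
    generalize dependent ((1 / 2) ^ m). intros; nra. }
  apply Rnot_lt_le. intros Hc.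
  assert (HK : 0 < 2 * (INR m + 1) * s) by (pose proof (pos_INR m); nra).
  (* This e gives m e s < (s - c)/2, so (1 - m e) s would still exceed c; the minimum with 1/2 keeps
     1 - e in (0,1). *)
  set (e := Rmin (1 / 2) ((s - c) / (2 * (INR m + 1) * s))).
  assert (He : 0 < e) by (apply Rmin_pos; [lra | apply Rdiv_lt_0_compat; lra]).
  assert (He1 : e <= 1 / 2) by apply Rmin_l.
  assert (He2 : e * (2 * (INR m + 1) * s) <= s - c).
  { apply Rle_trans with ((s - c) / (2 * (INR m + 1) * s) * (2 * (INR m + 1) * s)).
    - apply Rmult_le_compat_r; [lra | apply Rmin_r].
    - right. field. pose proof (pos_INR m). split; lra. }
  assert (Hx : 0 < 1 - e < 1) by lra.
  specialize (H _ Hx). pose proof (pow_ge_bernoulli (1 - e) m ltac:(lra)) as B.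
  replace (1 - (1 - e)) with e in B by ring.
  assert ((1 - INR m * e) * s <= (1 - e) ^ m * s) by (apply Rmult_le_compat_r; lra).
  assert (0 < e * s) by (apply Rmult_lt_0_compat; lra). lra.
Qed.

(** At real x the class condition becomes linear: the sum of (n - eta) b_n x^n is positive. As the
    terms have one sign from n = 2 on, a partial sum is controlled by the series; with N fixed, each
    x^(k+1) is at least x^(N+1), so x -> 1 involves one power only and no exchange of limits. *)
Lemma coef_sum_le (b : nat -> R) (eta : R) :
  normalized b -> 0 <= eta < 1 ->
  (forall z : C, Cmod z < 1 -> z <> 0 ->
    CPS b z <> 0 /\ Re (CPS (fun n => INR n * b n)%R z / CPS b z)%C > eta) ->
  forall N, sum_n (fun k => (INR (S (S k)) - eta) * (- b (S (S k)))) N <= 1 - eta.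
Proof.
  intros (H0 & H1 & H2 & Hb) Heta H N.
  assert (Hnb := rad1_mult_INR b Hb).
  assert (HR : forall x, 0 < x < 1 -> PSeries b x <> 0 /\
     PSeries (fun n => INR n * b n) x / PSeries b x > eta).
  { intros x Hx. destruct (H (RtoC x)) as [A1 A2].
    - rewrite Cmod_R, Rabs_pos_eq; lra.
    - intros E. apply RtoC_inj in E. lra.
    - rewrite !CPS_RtoC in *.
      assert (E : PSeries b x <> 0) by (intros E; apply A1; now rewrite E).
      split; [easy|]. rewrite <- RtoC_div, re_RtoC in A2; easy. }
  assert (Hpos := PSeries_positive b H0 H1 Hb (fun x Hx => proj1 (HR x Hx))).
  set (u := fun k => (INR (S (S k)) - eta) * (- b (S (S k)))).
  assert (Hu : forall k, 0 <= u k).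
  { intros k. apply Rmult_le_pos; [|specialize (H2 k); lra].
    rewrite !S_INR. pose proof (pos_INR k). lra. }
  apply le_of_pow_mult_le with (m := S N). intros x Hx.
  specialize (Hpos x Hx). destruct (HR x Hx) as [_ Hq].
  set (v := fun n => (INR n - eta) * b n * x ^ n).
  assert (X0 := ex_series_PS b x Hb ltac:(lra)).
  assert (X1 := ex_series_PS _ x Hnb ltac:(lra)).
  assert (Ev : ex_series v /\ Series v = PSeries (fun n => INR n * b n) x - eta * PSeries b x).
  { assert (Y := ex_series_Rscal eta _ X0). split.
    - apply (ex_series_Rext (fun n => INR n * b n * x ^ n - eta * (b n * x ^ n))).
      + intros n. unfold v. ring.
      + now apply (ex_series_minus (V := R_NormedModule)).
    - unfold PSeries. rewrite <- Series_scal_l, <- Series_minus by easy.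
      apply Series_ext. intros n. unfold v. ring. }
  destruct Ev as [Ev1 Ev2].
  assert (Pv : 0 < Series v).
  { rewrite Ev2. apply Rmult_lt_compat_r with (r := PSeries b x) in Hq; [|easy].
    unfold Rdiv in Hq. rewrite Rmult_assoc, Rinv_l in Hq by lra. lra. }
  assert (Ev3 : ex_series (fun n => v (S n))) by now apply (ex_series_incr_1 (V := R_NormedModule) v).
  assert (Ev4 : ex_series (fun n => v (S (S n)))) by now apply (ex_series_incr_1 (V := R_NormedModule) (fun n => v (S n))).
  (* The terms n = 0 and n = 1 are split off: they are 0 and (1 - eta) x. *)
  rewrite Series_incr_1 in Pv by easy. rewrite Series_incr_1 in Pv by easy.
  unfold v at 1 2 in Pv. rewrite H0, H1 in Pv. simpl INR in Pv.
  set (y := fun k => u k * x ^ S k).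
  assert (Ey : Series y = - / x * Series (fun n => v (S (S n))) /\ ex_series y).
  { assert (Y : forall k, - / x * v (S (S k)) = y k).
    { intros k. unfold v, y, u. rewrite <- (tech_pow_Rmult x (S k)). field. lra. }
    split.
    - rewrite <- Series_scal_l. apply Series_ext. intros k. now rewrite Y.
    - apply (ex_series_Rext _ _ Y). now apply ex_series_Rscal. }
  destruct Ey as [Ey1 Ey2].
  apply Rle_trans with (sum_n y N).
  - rewrite <- sum_n_Rscal. apply sum_n_Rle. intros k Hk. unfold y.
    rewrite Rmult_comm. apply Rmult_le_compat_l; [apply Hu|].
    replace (S N) with (S k + (N - k))%nat by lia. rewrite pow_add.
    assert (0 < x ^ S k) by (apply pow_lt; lra).
    assert (x ^ (N - k) <= 1) by (apply pow_le_1; lra). nra.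
  - eapply Rle_trans; [apply sum_n_le_Series; [|easy]|].
    + intros k. apply Rmult_le_pos; [apply Hu | apply pow_le; lra].
    + rewrite Ey1. set (W := Series (fun n => v (S (S n)))) in *.
      assert (0 < x * (1 - eta) + W) by (simpl in Pv; lra).
      apply Rmult_le_reg_l with x; [lra|].
      replace (x * (- / x * W)) with (- W) by (field; lra). lra.
Qed.

(** * The radius of convexity *)

(* The quantity under the root in r3. *)
Definition radius_base (p q tau eta rho : R) (xi kappa nu : nat) : R :=
  (1 - rho) * ((INR nu - eta) * factor p q tau nu * weight p q tau xi kappa nu)
    / (INR nu * (INR nu - rho) * (1 - eta)).

Lemma INR_SS_ge (k : nat) : 2 <= INR (S (S k)).
Proof. rewrite !S_INR. pose proof (pos_INR k). lra. Qed.

Lemma radius_base_pos (p q tau eta rho : R) (xi kappa k : nat) :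
  0 < p -> p < q -> q <= 1 -> 0 <= tau -> 0 <= eta < 1 -> 0 <= rho < 1 ->
  0 < factor p q tau (S (S k)) ->
  0 < radius_base p q tau eta rho xi kappa (S (S k)).
Proof.
  intros Hp Hpq Hq Ht He Hr Hf. pose proof (INR_SS_ge k).
  pose proof (weight_pos p q tau xi kappa (S k) Hp Hpq Hq Ht).
  apply Rdiv_lt_0_compat; repeat first [lra | apply Rmult_lt_0_compat].
Qed.

Lemma radius_term_pos (p q tau eta rho : R) (xi kappa nu : nat) :
  0 < radius_term p q tau eta rho xi kappa nu.
Proof. apply exp_pos. Qed.

(** The exponent 1/(nu - 1) cancels against nu - 1 = [S k]; positivity of the base makes [Rpower] a
    genuine root. *)
Lemma radius_term_pow (p q tau eta rho : R) (xi kappa k : nat) :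
  0 < p -> p < q -> q <= 1 -> 0 <= tau -> 0 <= eta < 1 -> 0 <= rho < 1 ->
  0 < factor p q tau (S (S k)) ->
  radius_term p q tau eta rho xi kappa (S (S k)) ^ S k
  = radius_base p q tau eta rho xi kappa (S (S k)).
Proof.
  intros Hp Hpq Hq Ht He Hr Hf.
  rewrite <- Rpower_pow by apply radius_term_pos. unfold radius_term.
  rewrite Rpower_mult.
  replace (1 / (INR (S (S k)) - 1) * INR (S k)) with 1.
  2:{ rewrite (S_INR (S k)). rewrite S_INR. pose proof (pos_INR k). field. lra. }
  pose proof (INR_SS_ge k).
  match goal with |- Rpower ?x 1 = ?y => assert (E : x = y) end.
  - unfold radius_base, weight. field. lra.
  - rewrite E. apply Rpower_1. now apply radius_base_pos.
Qed.

(** [real] sends infinite values to 0. An element of E bounds the infimum above and 0 bounds it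
    below, so it is finite and [real] loses nothing. *)
Lemma Glb_real_correct (E : R -> Prop) :
  (exists x, E x) -> (forall x, E x -> 0 <= x) ->
  (forall x, E x -> real (Glb_Rbar E) <= x) /\
  (forall r, (forall x, E x -> r <= x) -> r <= real (Glb_Rbar E)).
Proof.
  intros [x0 Hx0] H0. destruct (Glb_Rbar_correct E) as [L G].
  assert (F : is_finite (Glb_Rbar E)).
  { apply is_finite_correct. specialize (L x0 Hx0).
    specialize (G (Finite 0) (fun x Hx => H0 x Hx)).
    destruct (Glb_Rbar E); simpl in *; try easy. now eexists. }
  rewrite <- F in L, G. split.
  - intros x Hx. exact (L x Hx).
  - intros r Hr. exact (G (Finite r) (fun x Hx => Hr x Hx)).
Qed.

Lemma r3_glb (p q tau eta rho : R) (xi kappa : nat) :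
  (forall nu, (2 <= nu)%nat ->
     r3 p q tau eta rho xi kappa <= radius_term p q tau eta rho xi kappa nu) /\
  (forall r, (forall nu, (2 <= nu)%nat -> r <= radius_term p q tau eta rho xi kappa nu) ->
     r <= r3 p q tau eta rho xi kappa).
Proof.
  destruct (Glb_real_correct (fun x : R => exists nu : nat,
      (2 <= nu)%nat /\ x = radius_term p q tau eta rho xi kappa nu)) as [L G].
  - eexists. exists 2%nat. now split.
  - intros x (nu & _ & ->). left. apply radius_term_pos.
  - split.
    + intros nu Hnu. apply L. now exists nu.
    + intros r Hr. apply G. intros x (nu & Hnu & ->). now apply Hr.
Qed.

(* The base of the nu-th term grows at most polynomially in nu, so its
   (nu-1)-th root cannot stay above some s > 1. *)
Lemma r3_le_1 (p q tau eta rho : R) (xi kappa : nat) :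
  0 < p -> p < q -> q <= 1 -> 0 <= tau -> 0 <= eta < 1 -> 0 <= rho < 1 ->
  (forall nu : nat, (2 <= nu)%nat -> 0 < factor p q tau nu) ->
  r3 p q tau eta rho xi kappa <= 1.
Proof.
  intros Hp Hpq Hq Ht He Hr Hf. apply Rnot_lt_le. intros Hs.
  destruct (r3_glb p q tau eta rho xi kappa) as [L _].
  set (s := r3 p q tau eta rho xi kappa) in *.
  (* Up to the factor 1/(1 - eta), d majorizes the base; the trailing 1 is the coefficient of the
     geometric series, from which d inherits [rad1]. *)
  pose (d := fun n => INR n * (factor p q tau n * (weight p q tau xi kappa n * 1))).
  assert (Hd : rad1 d)
    by (apply rad1_mult_INR, rad1_factor; try easy; apply rad1_weight; try easy; apply rad1_one).
  assert (Hs1 : 0 < / s < 1).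
  { split; [apply Rinv_0_lt_compat; lra|]. rewrite <- Rinv_1. apply Rinv_lt_contravar; lra. }
  assert (X : ex_series (fun n => Rabs (d n) * (/ s) ^ n)) by (apply Hd; lra).
  apply ex_series_lim_0 in X. apply is_lim_seq_spec in X.
  (* If s > 1, then d_n s^(-n) tends to 0, whereas s^(nu-1) <= base <= d_nu / (1 - eta) keeps it at
     or above exactly this threshold. *)
  assert (Hc : 0 < (1 - eta) / s) by (apply Rdiv_lt_0_compat; lra).
  destruct (X (mkposreal _ Hc)) as [N HN].
  specialize (HN (S (S N)) ltac:(lia)).
  change (Rabs (Rabs (d (S (S N))) * (/ s) ^ S (S N) - 0) < (1 - eta) / s) in HN.
  pose proof (INR_SS_ge N) as Hnu. specialize (Hf (S (S N)) ltac:(lia)).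
  specialize (L (S (S N)) ltac:(lia)).
  pose proof (weight_pos p q tau xi kappa (S N) Hp Hpq Hq Ht) as Hw.
  assert (L' : s ^ S N <= radius_base p q tau eta rho xi kappa (S (S N))).
  { rewrite <- radius_term_pow by easy. apply pow_incr. split; [lra|easy]. }
  set (nu := S (S N)) in *. set (y := factor p q tau nu * weight p q tau xi kappa nu).
  assert (Hy : 0 < y) by now apply Rmult_lt_0_compat.
  assert (B : radius_base p q tau eta rho xi kappa nu <= d nu / (1 - eta)).
  { unfold radius_base, d.
    replace (INR nu * (factor p q tau nu * (weight p q tau xi kappa nu * 1))) with (INR nu * y) by (unfold y; ring).
    replace ((INR nu - eta) * factor p q tau nu * weight p q tau xi kappa nu) with ((INR nu - eta) * y) by (unfold y; ring).
    apply Rmult_le_reg_r with (INR nu * (INR nu - rho) * (1 - eta)).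
    { repeat apply Rmult_lt_0_compat; lra. }
    field_simplify; try lra.
    apply Rle_trans with ((INR nu - rho) * INR nu * INR nu * y); [|right; ring].
    apply Rle_trans with (((1 - rho) * (INR nu - eta)) * y); [right; ring|].
    apply Rmult_le_compat_r; [lra|].
    apply Rle_trans with ((INR nu - rho) * INR nu); [|nra].
    apply Rmult_le_compat; lra. }
  assert (Hdp : 0 < d nu).
  { unfold d. rewrite Rmult_1_r. apply Rmult_lt_0_compat; [lra | exact Hy]. }
  assert (0 < (/ s) ^ nu) by (apply pow_lt; lra).
  rewrite Rminus_0_r, Rabs_mult, Rabs_Rabsolu, (Rabs_pos_eq (d nu)), Rabs_pos_eq in HN by lra.
  assert (HA : (1 - eta) * s ^ S N <= d nu).
  { apply Rmult_le_reg_r with (/ (1 - eta)); [apply Rinv_0_lt_compat; lra|].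
    apply Rle_trans with (s ^ S N); [right; field; lra|]. eapply Rle_trans; [exact L'|exact B]. }
  assert (HB : (1 - eta) * s ^ S N * (/ s) ^ nu = (1 - eta) / s).
  { unfold nu. rewrite pow_inv, <- (tech_pow_Rmult s (S N)). field.
    split; try apply pow_nonzero; lra. }
  assert ((1 - eta) * s ^ S N * (/ s) ^ nu <= d nu * (/ s) ^ nu) by (apply Rmult_le_compat_r; lra).
  lra.
Qed.

(** * Convexity inside the radius *)

Lemma CPS_plus (u v : nat -> R) (z : C) :
  rad1 u -> rad1 v -> Cmod z < 1 ->
  (CPS u z + CPS v z)%C = CPS (fun n => u n + v n) z.
Proof.
  intros Hu Hv Hz. unfold CPS. rewrite <- CSeries_plus by now apply rad1_terms.
  apply CSeries_ext. intros n. rewrite RtoC_plus. ring.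
Qed.

Lemma convex_of_coef (phi : C -> C) (a : nat -> R) (rho M : R) (z : C) :
  normalized a -> (forall z, Cmod z < 1 -> phi z = CPS a z) ->
  0 <= rho < 1 -> M < 1 - rho -> Cmod z < 1 ->
  (forall N, sum_n (fun k => (INR (S (S k)) - rho)
      * (INR (S (S k)) * - a (S (S k))) * Cmod z ^ S k) N <= M) ->
  C_derive phi z <> 0 /\
  Re (1 + z * C_derive (C_derive phi) z / C_derive phi z)%C > rho.
Proof.
  intros Hn Hphi Hr HM Hz HN. pose proof Hn as (H0 & H1 & H2 & Ha).
  assert (Ha' := rad1_derive a Ha).
  set (g := fun n => INR n * a n). assert (Hg : rad1 g) by now apply rad1_mult_INR.
  assert (D1 := C_derive_on_disc phi a Ha Hphi).
  rewrite (C_derive_on_disc _ _ Ha' D1 z Hz), (D1 z Hz).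
  (* At the origin z phi' vanishes and the starlikeness estimate does not apply; there the convexity
     quotient is 1 > rho. *)
  destruct (Ceq_dec z 0) as [->|Hz0].
  - rewrite (CPS_0 (PS_derive a)) by easy. unfold PS_derive at 1 3. rewrite H1. simpl (INR 1).
    rewrite Rmult_1_r, Cmult_0_l. split; [apply C1_nz|].
    replace (1 + 0 / 1)%C with (RtoC 1) by (field; apply C1_nz). simpl. lra.
  - assert (Hgn : normalized g).
    { unfold g. repeat split; [rewrite H0; ring | rewrite H1; simpl; ring | | easy].
      intros k. specialize (H2 k). pose proof (INR_SS_ge k). nra. }
    destruct (starlike_of_coef g rho M z Hgn Hr HM Hz Hz0) as [G1 G2].
    { intros N. eapply Rle_trans; [|apply (HN N)]. right. apply sum_n_Rext.
      intros k. unfold g. ring. }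
    rewrite <- (mult_CPS_derive g) in G2 by easy.
    assert (Eg : CPS g z = (z * CPS (PS_derive a) z)%C)
      by (symmetry; now apply mult_CPS_derive).
    rewrite Eg in G1, G2.
    assert (D2 : CPS (PS_derive g) z
        = (CPS (PS_derive a) z + z * CPS (PS_derive (PS_derive a)) z)%C).
    { rewrite mult_CPS_derive, CPS_plus by (try apply rad1_mult_INR; easy).
      apply CPS_ext. intros n. unfold PS_derive, g. rewrite S_INR. ring. }
    assert (Hd : CPS (PS_derive a) z <> 0).
    { intros E. apply G1. rewrite E. ring. }
    split; [exact Hd|]. rewrite D2 in G2.
    replace (1 + _)%C with (z * (CPS (PS_derive a) z + z * CPS (PS_derive (PS_derive a)) z)
       / (z * CPS (PS_derive a) z))%C; [exact G2|].
    field. now split.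
Qed.

Lemma class_P_convex (p q tau eta rho : R) (xi kappa : nat) (phi : C -> C) :
  0 < p -> p < q -> q <= 1 -> 0 <= tau -> 0 <= eta < 1 -> 0 <= rho < 1 ->
  (forall nu : nat, (2 <= nu)%nat -> 0 < factor p q tau nu) ->
  class_P p q tau eta xi kappa phi ->
  convex_of_order rho (r3 p q tau eta rho xi kappa) phi.
Proof.
  intros Hp Hpq Hq Ht He Hr Hf [HQ HT] z Hz.
  destruct HT as (_ & c & Hc & Hs). destruct (neg_coef_CPS phi c Hc Hs) as [Hn Hphi].
  set (a := neg_coef c) in *. clearbody a. clear Hs.
  assert (Hr1 := r3_le_1 p q tau eta rho xi kappa Hp Hpq Hq Ht He Hr Hf).
  destruct (r3_glb p q tau eta rho xi kappa) as [L _].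
  set (s := r3 p q tau eta rho xi kappa) in *. pose proof (Cmod_ge_0 z) as Hz0.
  apply (class_Q_iff p q tau eta xi kappa phi a Hp Hpq Hq Ht Hn Hphi) in HQ.
  destruct HQ as [_ HQ].
  pose proof (coef_sum_le _ eta (qcoef_normalized p q tau xi kappa a Hp Hpq Hq Ht Hf Hn) He HQ) as Hsum.
  (* The strict gap comes from |z|/s < 1: one factor |z|/s is split off from |z|^(k+1), and the rest
     is bounded by s^(k+1), hence by the base. *)
  apply convex_of_coef with (a := a) (M := Cmod z / s * (1 - rho)); try easy.
  - rewrite <- (Rmult_1_l (1 - rho)) at 2. apply Rmult_lt_compat_r; [lra|].
    apply Rmult_lt_reg_r with s; [lra|]. unfold Rdiv. rewrite Rmult_assoc, Rinv_l by lra. lra.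
  - lra.
  - intros N. apply Rle_trans with (Cmod z / s * (1 - rho) / (1 - eta)
      * sum_n (fun k => (INR (S (S k)) - eta)
          * - qcoef p q tau xi kappa a (S (S k))) N).
    + rewrite <- sum_n_Rscal. apply sum_n_Rle. intros k _.
      specialize (Hf (S (S k)) ltac:(lia)).
      specialize (L (S (S k)) ltac:(lia)).
      pose proof (INR_SS_ge k) as Hk. destruct Hn as (_ & _ & H2 & _). specialize (H2 k).
      assert (L' : s ^ S k <= radius_base p q tau eta rho xi kappa (S (S k))).
      { rewrite <- radius_term_pow by easy. apply pow_incr. split; [lra|easy]. }
      assert (T : Cmod z ^ S k <= Cmod z / s * s ^ S k).
      { simpl. replace (Cmod z / s * (s * s ^ k)) with (Cmod z * s ^ k) by (field; lra).
        apply Rmult_le_compat_l; [easy|]. apply pow_incr. lra. }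
      assert (0 <= Cmod z / s) by (apply Rdiv_le_0_compat; lra).
      set (nu := S (S k)) in *.
      apply Rle_trans with ((INR nu - rho) * (INR nu * - a nu)
         * (Cmod z / s * radius_base p q tau eta rho xi kappa nu)).
      * apply Rmult_le_compat_l; [repeat apply Rmult_le_pos; lra|].
        eapply Rle_trans; [exact T|]. now apply Rmult_le_compat_l.
      (* An equality: the base is the ratio of the two coefficient conditions at nu, each scaled to
         right-hand side 1. *)
      * right. unfold radius_base, qcoef. field. lra.
    + replace (Cmod z / s * (1 - rho)) with (Cmod z / s * (1 - rho) / (1 - eta) * (1 - eta)) at 2 by (field; lra).
      apply Rmult_le_compat_l; [|apply Hsum].
      apply Rdiv_le_0_compat; [|lra]. apply Rmult_le_pos; [|lra]. apply Rdiv_le_0_compat; lra.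
Qed.

(** * The extremal functions *)

(** Valid in the whole plane: only the infimum of the radius terms is at most 1, and the test point
    for a single nu may lie outside the disc. The shape covers both the extremal function and its
    derivative. *)
Lemma is_derive_binomial (f : C -> C) (al be : C) (m n : nat) (z : C) :
  (forall w, f w = al * w ^ m + be * w ^ n)%C ->
  is_derive (K := C_AbsRing) (V := C_NormedModule) f z
    (al * (INR m * z ^ pred m) + be * (INR n * z ^ pred n))%C.
Proof.
  intros Hf. pose proof (Cmod_ge_0 z) as Hz.
  pose (M := Cmod z + 1). assert (HM : 0 < M ^ 2) by (apply pow_lt; unfold M; lra).
  pose (Q := fun j : nat => / M ^ 2 * (INR j ^ 2 * M ^ j)).
  assert (HQ : forall j, 0 <= Q j).
  { intros j. unfold Q. apply Rmult_le_pos; [left; now apply Rinv_0_lt_compat|].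
    apply Rmult_le_pos; apply pow_le; [apply pos_INR | unfold M; lra]. }
  apply is_derive_C_quadratic with (d := 1) (K := Cmod al * Q m + Cmod be * Q n); [lra| |].
  { apply Rplus_le_le_0_compat; apply Rmult_le_pos; try apply Cmod_ge_0; apply HQ. }
  intros h Hh.
  assert (B : forall j, Cmod (taylor2 j z h) <= Q j * Cmod h ^ 2).
  { intros j. apply Rmult_le_reg_l with (M ^ 2); [easy|].
    eapply Rle_trans; [apply Cmod_taylor2; unfold M; try lra|].
    - eapply Rle_trans; [apply Cmod_triangle|]. lra.
    - right. unfold Q. fold M. field. unfold M; lra. }
  rewrite !Hf.
  replace (_ - _ - _)%C with (al * taylor2 m z h + be * taylor2 n z h)%C
    by (unfold taylor2; ring).
  eapply Rle_trans; [apply Cmod_triangle|]. rewrite !Cmod_mult.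
  rewrite Rmult_plus_distr_r, !Rmult_assoc.
  apply Rplus_le_compat; apply Rmult_le_compat_l; try apply Cmod_ge_0; apply B.
Qed.

Lemma sum_n_single {G : AbelianMonoid} (m : nat) (v : G) (n : nat) :
  sum_n (fun k => if Nat.eqb k m then v else zero) n = if Nat.leb m n then v else zero.
Proof.
  induction n as [|n IH].
  - rewrite sum_O. now destruct m.
  - rewrite sum_Sn, IH.
    destruct (Nat.leb_spec m n); destruct (Nat.leb_spec m (S n));
      destruct (Nat.eqb_spec (S n) m); try lia;
      rewrite ?plus_zero_l, ?plus_zero_r; easy.
Qed.

Lemma is_series_single {K : AbsRing} {V : NormedModule K} (m : nat) (v : V) :
  is_series (fun k => if Nat.eqb k m then v else zero) v.
Proof.
  unfold is_series. apply filterlim_ext_loc with (f := fun _ => v); [|apply filterlim_const].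
  exists m. intros n Hn. rewrite sum_n_single. destruct (Nat.leb_spec m n); [easy|lia].
Qed.

Definition extremal_coef (p q tau eta : R) (xi kappa nu : nat) : R :=
  (1 - eta) / ((INR nu - eta) * factor p q tau nu * weight p q tau xi kappa nu).

Lemma extremal_eq (p q tau eta : R) (xi kappa nu : nat) (z : C) :
  extremal p q tau eta xi kappa nu z
  = (1 * z ^ 1 + (- extremal_coef p q tau eta xi kappa nu)%R * z ^ nu)%C.
Proof.
  unfold extremal, extremal_coef, weight. rewrite Cpow_1_r.
  replace (pq_number p q nu ^ kappa * (INR nu - eta) * factor p q tau nu
     * (1 + (INR nu - 1) * tau) ^ xi)
    with ((INR nu - eta) * factor p q tau nu * (pq_number p q nu ^ kappa
     * (1 + (INR nu - 1) * tau) ^ xi)) by ring.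
  rewrite RtoC_opp. ring.
Qed.

Lemma extremal_coef_pos (p q tau eta : R) (xi kappa k : nat) :
  0 < p -> p < q -> q <= 1 -> 0 <= tau -> 0 <= eta < 1 ->
  0 < factor p q tau (S (S k)) ->
  0 < extremal_coef p q tau eta xi kappa (S (S k)).
Proof.
  intros Hp Hpq Hq Ht He Hf. pose proof (INR_SS_ge k).
  pose proof (weight_pos p q tau xi kappa (S k) Hp Hpq Hq Ht).
  apply Rdiv_lt_0_compat; repeat first [lra | apply Rmult_lt_0_compat].
Qed.

Lemma C_derive_extremal (p q tau eta : R) (xi kappa nu : nat) (z : C) :
  C_derive (extremal p q tau eta xi kappa nu) z
  = (1 * z ^ 0 + (- extremal_coef p q tau eta xi kappa nu * INR nu)%R * z ^ pred nu)%C.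
Proof.
  rewrite (is_C_derive_unique _ _ _
    (is_derive_binomial _ _ _ _ _ z (extremal_eq p q tau eta xi kappa nu))).
  simpl. rewrite RtoC_mult. ring.
Qed.

Lemma extremal_class_A (p q tau eta : R) (xi kappa k : nat) :
  class_A (extremal p q tau eta xi kappa (S (S k))).
Proof.
  split; [|split].
  - intros z _. eexists. apply is_derive_binomial, extremal_eq.
  - rewrite extremal_eq, !Cpow_S. ring.
  - rewrite C_derive_extremal. simpl pred. rewrite Cpow_S. simpl. ring.
Qed.

Lemma extremal_is_series (p q tau eta : R) (xi kappa k : nat) (z : C) :
  is_series (K := C_AbsRing) (V := C_NormedModule)
    (fun j => RtoC (if Nat.eqb (j + 2) (S (S k))
        then extremal_coef p q tau eta xi kappa (S (S k)) else 0) * z ^ (j + 2))%C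
    (z - extremal p q tau eta xi kappa (S (S k)) z)%C.
Proof.
  rewrite extremal_eq. set (K := extremal_coef p q tau eta xi kappa (S (S k))).
  replace (z - (1 * z ^ 1 + (- K)%R * z ^ S (S k)))%C with (K * z ^ S (S k))%C
    by (rewrite Cpow_1_r, RtoC_opp; ring).
  refine (is_series_ext (V := C_NormedModule) _ _ _ _
    (is_series_single (V := C_NormedModule) k (K * z ^ S (S k))%C)).
  intros j. rewrite (Nat.add_comm j 2). simpl (Nat.eqb (2 + j) _).
  destruct (Nat.eqb_spec j k) as [->|]; [reflexivity|].
  symmetry. apply Cmult_0_l.
Qed.

(** The extremal coefficient gives equality in the coefficient condition. At z the weighted sum has
    the single term (1 - eta) |z|^(k+1) <= (1 - eta) |z|, which supplies the strict bound M. *)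
Lemma extremal_class_P (p q tau eta : R) (xi kappa k : nat) :
  0 < p -> p < q -> q <= 1 -> 0 <= tau -> 0 <= eta < 1 ->
  (forall nu : nat, (2 <= nu)%nat -> 0 < factor p q tau nu) ->
  class_P p q tau eta xi kappa (extremal p q tau eta xi kappa (S (S k))).
Proof.
  intros Hp Hpq Hq Ht He Hf.
  set (K := extremal_coef p q tau eta xi kappa (S (S k))).
  pose (c := fun n => if Nat.eqb n (S (S k)) then K else 0).
  assert (HfK := Hf (S (S k)) ltac:(lia)).
  assert (HK : 0 < K) by now apply extremal_coef_pos.
  assert (Hc : forall nu : nat, (2 <= nu)%nat -> 0 <= c nu).
  { intros nu _. unfold c. destruct (Nat.eqb nu _); lra. }
  assert (Hs := fun z (_ : in_disc z) => extremal_is_series p q tau eta xi kappa k z).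
  destruct (neg_coef_CPS _ c Hc Hs) as [Hn Hphi].
  assert (HA := extremal_class_A p q tau eta xi kappa k).
  split; [|split; [easy | now exists c]].
  apply (class_Q_iff p q tau eta xi kappa _ (neg_coef c) Hp Hpq Hq Ht Hn Hphi).
  split; [easy|]. intros z Hz Hz0. pose proof (Cmod_ge_0 z) as Hz1.
  apply starlike_of_coef with (M := (1 - eta) * Cmod z); try easy.
  - now apply qcoef_normalized.
  - rewrite <- (Rmult_1_r (1 - eta)) at 2. apply Rmult_lt_compat_l; lra.
  - intros N. eapply Rle_trans.
    + right. apply sum_n_Rext with (v := fun j => if Nat.eqb j k then (1 - eta) * Cmod z ^ S k else 0).
      intros j. unfold qcoef, neg_coef, c. simpl Nat.eqb.
      destruct (Nat.eqb_spec j k) as [->|]; [|ring].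
      pose proof (weight_pos p q tau xi kappa (S k) Hp Hpq Hq Ht).
      pose proof (INR_SS_ge k). unfold K, extremal_coef. field. lra.
    + assert (T : Cmod z ^ S k <= Cmod z).
      { simpl. pose proof (pow_le_1 (Cmod z) k ltac:(lra)). nra. }
      eapply Rle_trans; [right; exact (sum_n_single (G := R_AbelianMonoid) k _ N)|].
      destruct (Nat.leb k N).
      * apply Rmult_le_compat_l; lra.
      * change (0 <= (1 - eta) * Cmod z). apply Rmult_le_pos; lra.
Qed.

(* At the real point z = radius_term the convexity quotient equals rho. *)
Lemma extremal_not_convex (p q tau eta rho : R) (xi kappa k : nat) (r : R) :
  0 < p -> p < q -> q <= 1 -> 0 <= tau -> 0 <= eta < 1 -> 0 <= rho < 1 ->
  0 < factor p q tau (S (S k)) ->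
  radius_term p q tau eta rho xi kappa (S (S k)) < r ->
  ~ convex_of_order rho r (extremal p q tau eta xi kappa (S (S k))).
Proof.
  intros Hp Hpq Hq Ht He Hr Hf Hlt H.
  pose proof (radius_term_pos p q tau eta rho xi kappa (S (S k))) as Hx.
  pose proof (radius_term_pow p q tau eta rho xi kappa k Hp Hpq Hq Ht He Hr Hf) as Hpow.
  set (x := radius_term p q tau eta rho xi kappa (S (S k))) in *.
  assert (Hxr : Cmod x < r) by (rewrite Cmod_R, Rabs_pos_eq; lra).
  destruct (H x Hxr) as [_ HRe]. clear H Hxr.
  rewrite (is_C_derive_unique _ _ _ (is_derive_binomial _ _ _ _ _ x
    (C_derive_extremal p q tau eta xi kappa (S (S k))))) in HRe.
  rewrite C_derive_extremal in HRe.
  pose proof (INR_SS_ge k) as Hk.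
  pose proof (weight_pos p q tau xi kappa (S k) Hp Hpq Hq Ht) as Hw.
  set (K := extremal_coef p q tau eta xi kappa (S (S k))) in *.
  set (nu := INR (S (S k))) in *.
  assert (Hnu : INR (S k) = nu - 1) by (unfold nu; rewrite (S_INR (S k)); ring).
  (* Calling this value y, one has phi'(x) = 1 - y > 0 and the quotient is 1 - (nu - 1) y / (1 - y)
     = 1 - (nu - rho) y = rho. *)
  assert (HK : K * nu * x ^ S k = (1 - rho) / (nu - rho)).
  { rewrite Hpow. unfold K, extremal_coef, radius_base. fold nu. field. lra. }
  set (y := (1 - rho) / (nu - rho)) in *.
  assert (Hy1 : 1 - y = (nu - 1) / (nu - rho)) by (unfold y; field; lra).
  assert (Hy2 : 0 < 1 - y) by (rewrite Hy1; apply Rdiv_lt_0_compat; lra).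
  match goal with H : Re ?w > rho |- _ => replace w with (RtoC (1 + - ((nu - 1) * y) / (1 - y))) in H end.
  - rewrite re_RtoC, Hy1 in HRe.
    replace (1 + _) with rho in HRe by (unfold y; field; lra). lra.
  - simpl pred. rewrite Hnu. rewrite RtoC_plus, RtoC_div by lra. f_equal. f_equal.
    + rewrite <- HK. rewrite <- !RtoC_pow, <- !RtoC_mult, <- !RtoC_plus, <- !RtoC_mult.
      f_equal. simpl. ring.
    + rewrite <- HK. rewrite <- !RtoC_pow, <- !RtoC_mult, <- !RtoC_plus.
      f_equal. simpl. ring.
Qed.

Theorem corollary6p3 (p q tau eta rho : R) (xi kappa : nat)
  (hp : 0 < p) (hpq : p < q) (hq : q <= 1) (htau : 0 <= tau)
  (heta : 0 <= eta < 1) (hrho : 0 <= rho < 1)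
  (* the quantity under the root in r3 and the denominator of the extremal
     function are positive; automatic when tau <= 1 or q = 1 *)
  (hpos : forall nu : nat, (2 <= nu)%nat -> 0 < factor p q tau nu) :
  (forall phi : C -> C, class_P p q tau eta xi kappa phi ->
     convex_of_order rho (r3 p q tau eta rho xi kappa) phi)
  /\
  (forall r : R,
     (forall phi : C -> C, class_P p q tau eta xi kappa phi ->
        convex_of_order rho r phi) ->
     r <= r3 p q tau eta rho xi kappa)
  /\
  (forall nu : nat, (2 <= nu)%nat ->
     class_P p q tau eta xi kappa (extremal p q tau eta xi kappa nu) /\
     forall r : R, radius_term p q tau eta rho xi kappa nu < r ->
       ~ convex_of_order rho r (extremal p q tau eta xi kappa nu)).
Proof.
  assert (Ext : forall nu : nat, (2 <= nu)%nat ->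
     class_P p q tau eta xi kappa (extremal p q tau eta xi kappa nu) /\
     forall r : R, radius_term p q tau eta rho xi kappa nu < r ->
       ~ convex_of_order rho r (extremal p q tau eta xi kappa nu)).
  { intros [|[|k]] Hnu; [lia|lia|]. split.
    - now apply extremal_class_P.
    - intros r Hr. apply extremal_not_convex; try easy. now apply hpos. }
  split; [|split; [|exact Ext]].
  - intros phi Hphi. now apply class_P_convex.
  (* The infimum need not be attained, so r is compared with every radius term through the extremal
     function of that nu. *)
  - intros r Hr. apply r3_glb. intros nu Hnu. destruct (Ext nu Hnu) as [HP Hc].
    apply Rnot_lt_le. intros Hlt. exact (Hc r Hlt (Hr _ HP)).
Qed.
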